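(* Let $X$ be a finitistic space of cohomology type $(a,b)$, where $a$ is odd and $b$ is even. Then the group $G=\mathbb{Z}_2$ cannot act freely on $X$; that is, there is no free continuous action of $\mathbb{Z}_2$ on $X$.
   Context: A paracompact Hausdorff space is called finitistic if every open covering has a finite-dimensional (open) refinement. $H^*$ denotes Čech cohomology. Let $a,b$ be integers. A finitistic space $X$ has cohomology type $(a,b)$ if, for some integer $n\ge 1$, its only non-trivial integral cohomology groups are $H^{in}(X;\mathbb{Z})\cong\mathbb{Z}$ for $i=0,1,2,3$, with generators $v_i\in H^{in}(X;\mathbb{Z})$ satisfying $v_1^2=a v_2$ and $v_1v_2=b v_3$ (cup products). An action of $G$ on $X$ is free if for every $x\in X$ the isotropy subgroup $G_x=\{g\in G : gx=x\}$ is trivial. *)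

(* Defs.v *)
From HB Require Import structures.
From mathcomp Require Import all_boot all_order all_algebra all_fingroup.
From mathcomp Require Import all_classical all_reals topology ring.

Set Implicit Arguments.
Unset Strict Implicit.
Unset Printing Implicit Defensive.

Import Order.TTheory GRing.Theory Num.Theory.
Local Open Scope classical_set_scope.
Local Open Scope ring_scope.
Local Open Scope quotient_scope.

Section Covers.
Context {X : topologicalType}.
Implicit Types (U V W : set (set X)) (A B : set X) (p q r : set X -> set X).

Definition open_cover U := U `<=` open /\ \bigcup_(A in U) A = [set: X].

Definition refining_map W U p := forall A, W A -> U (p A) /\ A `<=` p A.

Definition refines W U := forall A, W A -> exists2 B, U B & A `<=` B.

(* The vertices of a simplex are ordered and may be repeated. *)
Definition nerve U (k : nat) (s : seq (set X)) :=
  [/\ size s = k.+1, forall A, A \in s -> U A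
    & \bigcap_(A in [set` s]) A !=set0].

Definition cover_dim_le U (d : nat) :=
  forall k s, nerve U k s -> uniq s -> (k <= d)%N.

Definition locally_finite U :=
  forall x : X, exists2 N, nbhs x N &
    finite_set [set A | U A /\ A `&` N !=set0].

Definition meet_cover U V := [set A `&` B | A in U & B in V].

Definition refine_map U A : set X := xget setT [set B | U B /\ A `<=` B].

Lemma refine_mapP W U : refines W U -> refining_map W U (refine_map U).
Proof.
move=> WU A WA; rewrite /refine_map; case: xgetP => [B _ []//|noB].
by have [B UB AB] := WU _ WA; case: (noB B).
Qed.

Lemma refining_refines W U p : refining_map W U p -> refines W U.
Proof. by move=> h A /h[UA AB]; exists (p A). Qed.

Lemma refining_comp W V U p q :
  refining_map W V p -> refining_map V U q -> refining_map W U (q \o p).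
Proof.
move=> hp hq A /hp[VA AV]; have [UA VU] := hq _ VA; split=> //.
exact: subset_trans VU.
Qed.

Lemma open_cover_meet U V :
  open_cover U -> open_cover V -> open_cover (meet_cover U V).
Proof.
move=> [oU cU] [oV cV]; split=> [_ [A UA [B VB <-]]|].
  by apply: openI; [exact: oU|exact: oV].
apply/seteqP; split=> // x _.
have [A UA Ax] : (\bigcup_(A in U) A) x by rewrite cU.
have [B VB Bx] : (\bigcup_(A in V) A) x by rewrite cV.
by exists (A `&` B) => //; exists A => //; exists B.
Qed.

Lemma meet_refinesl U V : refines (meet_cover U V) U.
Proof. by move=> _ [A UA [B VB <-]]; exists A => // x []. Qed.

Lemma meet_refinesr U V : refines (meet_cover U V) V.
Proof. by move=> _ [A UA [B VB <-]]; exists B => // x []. Qed.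

Lemma refines_meet U V W : refines W U -> refines W V ->
  refines W (meet_cover U V).
Proof.
move=> WU WV A WA; have [B UB AB] := WU _ WA; have [C VC AC] := WV _ WA.
exists (B `&` C); first by exists B => //; exists C.
by move=> x Ax; split; [exact: AB|exact: AC].
Qed.

Lemma refines_trans W V U : refines W V -> refines V U -> refines W U.
Proof.
move=> WV VU A /WV[B /VU[C UC BC] AB]; exists C => //.
exact: subset_trans BC.
Qed.

Lemma open_cover_setT : open_cover [set [set: X]].
Proof.
split=> [_ ->|]; first exact: openT.
by apply/seteqP; split=> // x _; exists setT.
Qed.

Lemma nerve_map W U p k s :
  refining_map W U p -> nerve W k s -> nerve U k (map p s).
Proof.
move=> hp [ss sW [x sx]]; split; first by rewrite size_map.
  by move=> _ /mapP[A /sW WA ->]; have [] := hp _ WA.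
exists x => _ /= /mapP[A As ->].
by have [_] := hp _ (sW _ As); apply; exact: sx.
Qed.

Lemma sub_nerve U k l s t : nerve U k s -> {subset t <= s} ->
  size t = l.+1 -> nerve U l t.
Proof.
move=> [_ sU [x sx]] ts st; split=> // [A /ts/sU//|].
by exists x => A /= /ts; exact: sx.
Qed.

End Covers.

Definition paracompact (X : topologicalType) :=
  forall U : set (set X), open_cover U ->
    exists V, [/\ open_cover V, refines V U & locally_finite V].

Definition finitistic (X : topologicalType) :=
  [/\ hausdorff_space X, paracompact X
    & forall U : set (set X), open_cover U ->
        exists V, [/\ open_cover V, refines V U
                    & exists d, cover_dim_le V d]].

(* A [k]-cochain of [U] is given by a total function on sequences, of which
   only the values on [nerve U k] are relevant. *)
Section Cochains.
Context {R : comNzRingType} {X : topologicalType}.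
Local Notation cochain := (seq (set X) -> R).
Implicit Types (U V W : set (set X)) (p q r : set X -> set X).
Implicit Types (b c d : cochain) (s t : seq (set X)).

Definition delta c : cochain := fun s =>
  \sum_(i < size s) (-1) ^+ i * c (take i s ++ drop i.+1 s).

Definition cocycle U k c := forall s, nerve U k.+1 s -> delta c s = 0.

Definition coboundary U k c :=
  if k is j.+1 then exists b, forall s, nerve U j.+1 s -> c s = delta b s
  else forall s, nerve U 0 s -> c s = 0.

Definition pullback p c : cochain := c \o map p.

Definition cup_cochain (k : nat) c d : cochain :=
  fun s => c (take k.+1 s) * d (drop k s).

Lemma delta_nil c : delta c [::] = 0.
Proof. by rewrite /delta big_ord0. Qed.

Lemma delta_cons c A s :
  delta c (A :: s) = c s - delta (fun t => c (A :: t)) s.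
Proof.
rewrite /delta /= big_ord_recl /= expr0 mul1r drop0; congr (_ + _).
rewrite -sumrN; apply: eq_bigr => i _.
by rewrite /bump /= add1n exprS mulN1r mulNr.
Qed.

Lemma deltaD c d s : delta (c + d) s = delta c s + delta d s.
Proof.
by rewrite /delta -big_split; apply: eq_bigr => i _ /=; rewrite -mulrDr.
Qed.

Lemma deltaN c s : delta (- c) s = - delta c s.
Proof. by rewrite /delta -sumrN; apply: eq_bigr => i _; rewrite -mulrN. Qed.

Lemma delta0 s : delta 0 s = 0.
Proof. by rewrite /delta big1 // => i _; rewrite mulr0. Qed.

Lemma delta_delta c s : delta (delta c) s = 0.
Proof.
elim: s c => [|A s IH] c; first exact: delta_nil.
rewrite delta_cons.
have -> : (fun t => delta c (A :: t)) = c - delta (fun t => c (A :: t)).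
  by apply/funext => t; rewrite delta_cons.
by rewrite deltaD deltaN IH subr0 subrr.
Qed.

Lemma delta_pullback p c s : delta (pullback p c) s = delta c (map p s).
Proof.
rewrite /delta size_map; apply: eq_bigr => i _.
by rewrite /pullback /= map_cat map_take map_drop.
Qed.

Lemma eq_nerve_delta U k c d s :
  (forall t, nerve U k t -> c t = d t) -> nerve U k.+1 s ->
  delta c s = delta d s.
Proof.
move=> cd ns; apply: eq_bigr => i _; congr (_ * _); apply: cd.
have [ss _ _] := ns; case: i => i /= hi; apply: sub_nerve ns _ _.
  by move=> A; rewrite mem_cat => /orP[/mem_take|/mem_drop].
rewrite size_cat size_takel 1?ltnW // size_drop.
by move: hi; rewrite ss => hi; rewrite subSS subnKC.
Qed.

Lemma pullback_comp p r c : pullback (p \o r) c = pullback r (pullback p c).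
Proof. by apply/funext => s; rewrite /pullback /= map_comp. Qed.

Lemma cocycleD U k c d : cocycle U k c -> cocycle U k d -> cocycle U k (c + d).
Proof. by move=> hc hd s ns; rewrite deltaD hc ?hd ?addr0. Qed.

Lemma cocycleN U k c : cocycle U k c -> cocycle U k (- c).
Proof. by move=> hc s ns; rewrite deltaN hc ?oppr0. Qed.

Lemma cocycle0 U k : cocycle U k 0.
Proof. by move=> s ns; rewrite delta0. Qed.

Lemma cocycle_pullback W U p k c : refining_map W U p ->
  cocycle U k c -> cocycle W k (pullback p c).
Proof.
by move=> hp hc s ns; rewrite delta_pullback; apply/hc/(nerve_map hp).
Qed.

Lemma coboundary_cocycle U k c : coboundary U k c -> cocycle U k c.
Proof.
case: k => [|k] /= => [h|[b h]] s ns.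
  rewrite (@eq_nerve_delta U 0 c 0) ?delta0 // => t; exact: h.
rewrite (@eq_nerve_delta U k.+1 c (delta b)) ?delta_delta // => t; exact: h.
Qed.

Lemma coboundary_eq U k c d : (forall s, nerve U k s -> c s = d s) ->
  coboundary U k c -> coboundary U k d.
Proof.
case: k => [|k] cd /= => [h s ns|[b h]]; first by rewrite -cd ?h.
by exists b => s ns; rewrite -cd ?h.
Qed.

Lemma coboundary0 U k : coboundary U k 0.
Proof. by case: k => //= k; exists 0 => s _; rewrite delta0. Qed.

Lemma coboundaryD U k c d :
  coboundary U k c -> coboundary U k d -> coboundary U k (c + d).
Proof.
case: k => [|k] /= => [hc hd s ns|[b hb] [b' hb']].
  have -> : (c + d) s = c s + d s by [].
  by rewrite hc ?hd ?addr0.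
exists (b + b') => s ns; rewrite deltaD -hb -?hb' //.
Qed.

Lemma coboundaryN U k c : coboundary U k c -> coboundary U k (- c).
Proof.
case: k => [|k] /= => [hc s ns|[b hb]].
  by have -> : (- c) s = - c s by []; rewrite hc ?oppr0.
by exists (- b) => s ns; rewrite deltaN -hb.
Qed.

Lemma coboundary_pullback W U p k c : refining_map W U p ->
  coboundary U k c -> coboundary W k (pullback p c).
Proof.
case: k => [|k] hp /= => [h s ns|[b h]].
  by apply: h; exact: nerve_map ns.
exists (pullback p b) => s ns; rewrite delta_pullback -h //.
exact: nerve_map ns.
Qed.

Fixpoint prism p q c s : R :=
  if s is A :: s' then
    c (p A :: q A :: map q s') - prism p q (fun t => c (p A :: t)) s'
  else 0.

Lemma prismB p q c d s : prism p q (c - d) s = prism p q c s - prism p q d s.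
Proof.
elim: s c d => [|A s IH] c d /=; first by rewrite subrr.
have -> : (fun t => (c - d) (p A :: t)) =
          (fun t => c (p A :: t)) - (fun t => d (p A :: t)) by [].
have -> : (c - d) (p A :: q A :: map q s) =
          c (p A :: q A :: map q s) - d (p A :: q A :: map q s) by [].
by rewrite IH; ring.
Qed.

Lemma deltaB c d s : delta (c - d) s = delta c s - delta d s.
Proof. by rewrite deltaD deltaN. Qed.

Lemma prism_homotopy p q c s :
  delta (prism p q c) s + prism p q (delta c) s = c (map q s) - c (map p s).
Proof.
elim: s c => [|A s IH] c; first by rewrite delta_nil /= addr0 subrr.
rewrite delta_cons /=.
have -> : (fun t => prism p q c (A :: t)) =
    pullback q (fun t => c (p A :: q A :: t)) -
    prism p q (fun t => c (p A :: t)) by [].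
have -> : (fun t => delta c (p A :: t)) = c - delta (fun t => c (p A :: t)).
  by apply/funext => t; rewrite delta_cons.
rewrite deltaB prismB delta_pullback !delta_cons.
have := IH (fun t => c (p A :: t)).
move: (delta (prism p q _) s) => x /(canRL (addrK _)) ->.
by ring.
Qed.

Lemma prism_nerve W U p q k c s :
  refining_map W U p -> refining_map W U q ->
  (forall t, nerve U k.+1 t -> c t = 0) -> nerve W k s -> prism p q c s = 0.
Proof.
move=> hp hq hc [ss sW [x sx]].
have {}hc t : size t = k.+2 -> (forall A, A \in t -> U A /\ A x) -> c t = 0.
  move=> st tU; apply: hc; split=> // [A /tU[]//|].
  by exists x => A /= /tU[].
have {sW sx}: forall A, A \in s -> (U (p A) /\ p A x) /\ (U (q A) /\ q A x).
  move=> A As; have Ax := sx _ As.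
  have [? h1] := hp _ (sW _ As); have [? h2] := hq _ (sW _ As).
  by split; split=> //; [exact: h1|exact: h2].
elim: s k c ss hc => [//|A s IH] k c /= [ss] hc sU.
rewrite hc; last 2 first.
- by rewrite /= size_map ss.
- move=> B; rewrite !inE => /or3P[/eqP->|/eqP->|/mapP[C Cs ->]].
  + by have [] := sU A (mem_head _ _).
  + by have [] := sU A (mem_head _ _).
  + by have [] := sU C (@mem_behead _ (A :: s) _ Cs).
rewrite sub0r; case: k ss hc => [/size0nil -> _|k ss hc]; first exact: oppr0.
rewrite (IH k) ?oppr0 //.
- move=> t st tU; apply: hc; first by rewrite /= st.
  move=> B; rewrite inE => /orP[/eqP->|/tU//].
  by have [] := sU A (mem_head _ _).
- by move=> B Bs; exact: sU (@mem_behead _ (A :: s) _ Bs).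
Qed.

(* The transition maps do not depend on the choice of a refining map. *)
Lemma refining_map_indep W U p q k c :
  refining_map W U p -> refining_map W U q -> cocycle U k c ->
  coboundary W k (pullback q c - pullback p c).
Proof.
move=> hp hq hc.
have dh s : nerve W k s ->
    (pullback q c - pullback p c) s = delta (prism p q c) s.
  move=> ns; have -> : (pullback q c - pullback p c) s =
    c (map q s) - c (map p s) by [].
  by rewrite -prism_homotopy (prism_nerve hp hq hc ns) addr0.
case: k hc dh => [|k] hc dh; last by exists (prism p q c).
move=> s ns; rewrite dh //; case: ns => + _ _.
by case: s => // A [|]// _; rewrite delta_cons !delta_nil subr0.
Qed.

Lemma delta_cup k l c d s : size s = (k + l).+2 ->
  delta (cup_cochain k c d) s =
  cup_cochain k.+1 (delta c) d s + (-1) ^+ k * cup_cochain k c (delta d) s.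
Proof.
elim: k c s => [|k IH] c [//|A s] /= [ss].
  case: s ss => [//|B s] ss.
  rewrite delta_cons.
  have -> : delta (fun t => cup_cochain 0 c d (A :: t)) (B :: s) =
            c [:: A] * delta (fun t => d (A :: t)) (B :: s).
    rewrite /delta big_distrr; apply: eq_bigr => i _ /=.
    by rewrite /cup_cochain /= take0 mulrCA.
  have -> : cup_cochain 0 c d (B :: s) = c [:: B] * d (B :: s).
    by rewrite /cup_cochain /= take0.
  have -> : cup_cochain 1 (delta c) d [:: A, B & s] =
            delta c [:: A; B] * d (B :: s).
    by rewrite /cup_cochain /= take0.
  have -> : cup_cochain 0 c (delta d) [:: A, B & s] =
            c [:: A] * delta d [:: A, B & s] by [].
  rewrite [delta c _]delta_cons [delta d _]delta_cons.
  rewrite [delta _ [:: B]]delta_cons delta_nil.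
  by ring.
rewrite delta_cons.
have -> : (fun t => cup_cochain k.+1 c d (A :: t)) =
  cup_cochain k (fun t => c (A :: t)) d by [].
rewrite IH // /cup_cochain /= !delta_cons exprS.
by ring.
Qed.

Lemma nerve_take U k l s : nerve U (k + l) s -> nerve U k (take k.+1 s).
Proof.
move=> ns; have [ss _ _] := ns; apply: sub_nerve ns _ _.
  by move=> A /mem_take.
by rewrite size_takel // ss ltnS leq_addr.
Qed.

Lemma nerve_drop U k l s : nerve U (k + l) s -> nerve U l (drop k s).
Proof.
move=> ns; have [ss _ _] := ns; apply: sub_nerve ns _ _.
  by move=> A /mem_drop.
by rewrite size_drop ss -addnS addKn.
Qed.

Lemma cocycle_cup U k l c d : cocycle U k c -> cocycle U l d ->
  cocycle U (k + l) (cup_cochain k c d).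
Proof.
move=> hc hd s ns; have [ss _ _] := ns; rewrite (delta_cup _ _ ss).
rewrite /cup_cochain hc; last by apply: (@nerve_take U k.+1 l); rewrite addSn.
by rewrite hd ?mul0r ?mulr0 ?addr0 //; apply: nerve_drop; rewrite addnS.
Qed.

Lemma coboundary_cupl U k l c d : coboundary U k c -> cocycle U l d ->
  coboundary U (k + l) (cup_cochain k c d).
Proof.
case: k => [|k] /= => [h|[b h]] hd.
  apply: coboundary_eq (coboundary0 _ _) => s ns.
  by rewrite /cup_cochain h ?mul0r //; exact: nerve_take ns.
exists (cup_cochain k b d) => s ns; have [ss _ _] := ns.
rewrite (delta_cup _ _ ss) /cup_cochain hd ?mulr0 ?addr0.
  by rewrite h //; exact: (@nerve_take U k.+1 l).
by apply: nerve_drop; rewrite addnS.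
Qed.

Lemma coboundary_cupr U k l c d : cocycle U k c -> coboundary U l d ->
  coboundary U (k + l) (cup_cochain k c d).
Proof.
case: l => [|l] /= hc => [h|[b h]].
  apply: coboundary_eq (coboundary0 _ _) => s ns.
  by rewrite /cup_cochain h ?mulr0 //; exact: nerve_drop ns.
rewrite addnS; exists ((fun=> (-1) ^+ k) * cup_cochain k c b) => s ns.
have [ss _ _] := ns.
have -> : delta ((fun=> (-1) ^+ k) * cup_cochain k c b) s =
          (-1) ^+ k * delta (cup_cochain k c b) s.
  by rewrite /delta big_distrr; apply: eq_bigr => i _ /=; rewrite mulrCA.
rewrite (delta_cup _ _ ss) {2}/cup_cochain hc; last first.
  by apply: (@nerve_take U k.+1 l); rewrite addSn.
rewrite mul0r add0r mulrA -expr2 sqrr_sign mul1r /cup_cochain h //.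
by apply: nerve_drop; rewrite addnS.
Qed.

End Cochains.

Section CechCohomology.
Variables (R : comNzRingType) (X : topologicalType).
Local Notation cochain := (seq (set X) -> R).

Record cech_cocycle (k : nat) := CechCocycle {
  cc_cover : set (set X);
  cc_fun :> cochain;
  cc_open : open_cover cc_cover;
  cc_cocycle : cocycle cc_cover k cc_fun }.

HB.instance Definition _ k := gen_eqMixin (cech_cocycle k).
HB.instance Definition _ k := gen_choiceMixin (cech_cocycle k).

(* Equality of the classes of [x] and [y] in the direct limit, over the open
   coverings of [X], of the cohomology groups of their nerves. *)
Definition cohomologous k (x y : cech_cocycle k) :=
  exists W p q, [/\ open_cover W, refining_map W (cc_cover x) p,
    refining_map W (cc_cover y) q
    & coboundary W k (pullback p x - pullback q y)].

Definition represents k W (x : cech_cocycle k) (c : cochain) :=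
  exists2 p, refining_map W (cc_cover x) p &
    coboundary W k (pullback p x - c).

Lemma represents_pullback k W (x : cech_cocycle k) p :
  refining_map W (cc_cover x) p -> represents W x (pullback p x).
Proof. by exists p => //; rewrite subrr; exact: coboundary0. Qed.

Lemma cohomologousP k (x y : cech_cocycle k) : cohomologous x y <->
  exists W c, [/\ open_cover W, represents W x c & represents W y c].
Proof.
split=> [[W [p [q [oW hp hq h]]]]|[W [c [oW [p hp h] [q hq h']]]]].
  exists W, (pullback q y); split=> //; first by exists p.
  exact: represents_pullback.
exists W, p, q; split=> //.
have -> : pullback p x - pullback q y =
  (pullback p x - c) - (pullback q y - c) by rewrite opprB addrA subrK.
exact/(coboundaryD h)/coboundaryN.
Qed.

Lemma represents_uniq k W (x : cech_cocycle k) c d :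
  represents W x c -> represents W x d -> coboundary W k (c - d).
Proof.
move=> [p hp h] [q hq h'].
have H := refining_map_indep hp hq (cc_cocycle (c := x)).
have -> : c - d = (pullback q x - d) - (pullback q x - pullback p x)
   - (pullback p x - c).
  apply/funext => s; move: (pullback p x) (pullback q x) => P Q.
  by rewrite !fctE; ring.
exact: coboundaryD (coboundaryD h' (coboundaryN H)) (coboundaryN h).
Qed.

Lemma represents_refine k W W' r (x : cech_cocycle k) c :
  refining_map W' W r -> represents W x c -> represents W' x (pullback r c).
Proof.
move=> hr [p hp h]; exists (p \o r); first exact: refining_comp hp.
have -> : pullback (p \o r) x - pullback r c =
          pullback r (pullback p x - c).
  by apply/funext => s; rewrite !fctE /pullback /= map_comp.
exact: (coboundary_pullback hr h).
Qed.

Lemma represents_cocycle k W (x : cech_cocycle k) c :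
  represents W x c -> cocycle W k c.
Proof.
move=> [p hp h]; have -> : c = pullback p x - (pullback p x - c).
  by rewrite opprB addrC subrK.
apply: cocycleD; first exact: cocycle_pullback (cc_cocycle (c := x)).
exact/cocycleN/coboundary_cocycle.
Qed.

Lemma represents_ex k W (x : cech_cocycle k) :
  refines W (cc_cover x) -> exists c, represents W x c.
Proof.
by move=> /refine_mapP h; exists (pullback (refine_map (cc_cover x)) x);
  exact: represents_pullback.
Qed.

Lemma represents_refines k W (x : cech_cocycle k) c :
  represents W x c -> refines W (cc_cover x).
Proof. by case=> p /refining_refines. Qed.

Lemma cohomologous_refl k (x : cech_cocycle k) : cohomologous x x.
Proof.
have id_ref : refining_map (cc_cover x) (cc_cover x) id.
  by move=> A UA; split.
exists (cc_cover x), id, id; split=> //; first exact: cc_open.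
by rewrite subrr; exact: coboundary0.
Qed.

Lemma cohomologous_sym k (x y : cech_cocycle k) :
  cohomologous x y -> cohomologous y x.
Proof.
move=> [W [p [q [oW hp hq h]]]]; exists W, q, p; split=> //.
by rewrite -opprB; exact: coboundaryN.
Qed.

Lemma represents_eq k W (x : cech_cocycle k) c d :
  represents W x c -> coboundary W k (c - d) -> represents W x d.
Proof.
move=> [p hp h] h'; exists p => //.
have -> : pullback p x - d = (pullback p x - c) + (c - d).
  by rewrite addrA subrK.
exact: coboundaryD.
Qed.

(* Cohomologous cocycles have the same representatives on a fine enough
   covering. *)
Lemma cohomologous_represents k (x y : cech_cocycle k) : cohomologous x y ->
  exists2 W, open_cover W & forall W', refines W' W ->
    forall c, represents W' x c <-> represents W' y c.
Proof.
move=> /cohomologousP[W [c [oW xc yc]]]; exists W => // W' W'W d.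
have hr := refine_mapP W'W.
have {}xc := represents_refine hr xc; have {}yc := represents_refine hr yc.
split=> h.
  exact: represents_eq yc (represents_uniq xc h).
exact: represents_eq xc (represents_uniq yc h).
Qed.

Lemma cohomologous_trans k (y x z : cech_cocycle k) :
  cohomologous x y -> cohomologous y z -> cohomologous x z.
Proof.
move=> /cohomologous_represents[W1 o1 h1] /cohomologous_represents[W2 o2 h2].
pose W := meet_cover (meet_cover W1 W2) (cc_cover x).
have [c xc] : exists c, represents W x c.
  by apply: represents_ex; exact: meet_refinesr.
have rW : refines W (meet_cover W1 W2) by exact: meet_refinesl.
have r1 : refines W W1 := refines_trans rW (@meet_refinesl _ _ _).
have r2 : refines W W2 := refines_trans rW (@meet_refinesr _ _ _).
apply/cohomologousP; exists W, c; split=> //.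
  by do ?apply: open_cover_meet => //; exact: cc_open.
by apply/(h2 _ r2)/(h1 _ r1).
Qed.

Definition cohomologousb k (x y : cech_cocycle k) := `[< cohomologous x y >].

Lemma cohomologousb_equiv k : equiv_class_of (@cohomologousb k).
Proof.
split=> [x|x y|y x z]; first exact/asboolP/cohomologous_refl.
  by apply/asboolP/asboolP; exact: cohomologous_sym.
move=> /asboolP xy /asboolP yz; exact/asboolP/(cohomologous_trans xy).
Qed.

Canonical cohomologous_equiv k := EquivRelPack (@cohomologousb_equiv k).

Definition cech k := {eq_quot (cohomologous_equiv k)}.

HB.instance Definition _ k : EqQuotient _ (cohomologous_equiv k) (cech k) :=
  EqQuotient.on (cech k).
HB.instance Definition _ k := Choice.on (cech k).

Definition cech_class k (x : cech_cocycle k) : cech k := \pi_(cech k) x.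

Lemma cech_classP k (x y : cech_cocycle k) :
  cech_class x = cech_class y <-> cohomologous x y.
Proof. by split=> [/eqmodP/asboolP|h]//; apply/eqmodP/asboolP. Qed.

Lemma cech_ind k (P : cech k -> Prop) :
  (forall x, P (cech_class x)) -> forall u, P u.
Proof. by move=> h; elim/quotW. Qed.

Definition zero_cocycle (k : nat) :=
  CechCocycle open_cover_setT (@cocycle0 R X _ k).

Definition opp_cocycle k (x : cech_cocycle k) :=
  CechCocycle (cc_open x) (cocycleN (cc_cocycle (c := x))).

Lemma pullback_cocycle U V k (x : cech_cocycle k) :
  refines (meet_cover U V) (cc_cover x) ->
  cocycle (meet_cover U V) k (pullback (refine_map (cc_cover x)) x).
Proof.
by move=> h; apply: cocycle_pullback (cc_cocycle (c := x)); exact: refine_mapP.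
Qed.

Definition add_cocycle k (x y : cech_cocycle k) :=
  CechCocycle (open_cover_meet (cc_open x) (cc_open y))
    (cocycleD (pullback_cocycle (@meet_refinesl _ _ _))
              (pullback_cocycle (@meet_refinesr _ _ _))).

Definition cup_cocycle k l (x : cech_cocycle k) (y : cech_cocycle l) :=
  CechCocycle (open_cover_meet (cc_open x) (cc_open y))
    (cocycle_cup (pullback_cocycle (@meet_refinesl _ _ _))
                 (pullback_cocycle (@meet_refinesr _ _ _))).

Lemma represents_zero k W : represents W (zero_cocycle k) 0.
Proof.
exists (fun=> setT); first by move=> A _; split.
by rewrite subr0; exact: coboundary0.
Qed.

Lemma represents_opp k W (x : cech_cocycle k) c :
  represents W x c -> represents W (opp_cocycle x) (- c).
Proof.
move=> [p hp h]; exists p => //=.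
have -> : pullback p (- (x : cochain)) - - c = - (pullback p x - c).
  by rewrite opprD.
exact: coboundaryN.
Qed.

Lemma represents_add k W (x y : cech_cocycle k) c d :
  represents W x c -> represents W y d ->
  represents W (add_cocycle x y) (c + d).
Proof.
move=> xc yd; have Wx := represents_refines xc.
have Wy := represents_refines yd.
have hr := refine_mapP (refines_meet Wx Wy); set r := refine_map _ in hr.
exists r => //=.
have xr := represents_pullback
  (refining_comp hr (refine_mapP (@meet_refinesl _ _ _))).
have yr := represents_pullback
  (refining_comp hr (refine_mapP (@meet_refinesr _ _ _))).
have -> : pullback r (pullback (refine_map (cc_cover x)) x +
            pullback (refine_map (cc_cover y)) y) - (c + d) =
   (pullback (refine_map (cc_cover x) \o r) x - c) +
   (pullback (refine_map (cc_cover y) \o r) y - d).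
  by rewrite !pullback_comp; apply/funext => s; rewrite /pullback !fctE; ring.
by apply: coboundaryD; [exact: represents_uniq xr xc|
                        exact: represents_uniq yr yd].
Qed.

Lemma represents_cup k l W (x : cech_cocycle k) (y : cech_cocycle l) c d :
  represents W x c -> represents W y d ->
  represents W (cup_cocycle x y) (cup_cochain k c d).
Proof.
move=> xc yd; have Wx := represents_refines xc.
have Wy := represents_refines yd.
have hr := refine_mapP (refines_meet Wx Wy); set r := refine_map _ in hr.
exists r => //=.
have xr := represents_pullback
  (refining_comp hr (refine_mapP (@meet_refinesl _ _ _))).
have yr := represents_pullback
  (refining_comp hr (refine_mapP (@meet_refinesr _ _ _))).
set c' := pullback _ _ in xr; set d' := pullback _ _ in yr.
have -> : pullback r (cup_cochain k (pullback (refine_map (cc_cover x)) x)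
            (pullback (refine_map (cc_cover y)) y)) - cup_cochain k c d =
   cup_cochain k (c' - c) d' + cup_cochain k c (d' - d).
  apply/funext => s.
  have E (f g : cochain) : (f + g) s = f s + g s by [].
  have -> : (cup_cochain k (c' - c) d' + cup_cochain k c (d' - d)) s =
    (c' (take k.+1 s) - c (take k.+1 s)) * d' (drop k s) +
    c (take k.+1 s) * (d' (drop k s) - d (drop k s)) by [].
  rewrite mulrBl mulrBr addrA subrK; congr (_ - _).
  rewrite /c' /d' !pullback_comp /cup_cochain.
  by rewrite /pullback /= !map_take !map_drop.
apply: coboundaryD.
  by apply: coboundary_cupl (represents_uniq xr xc) (represents_cocycle yr).
by apply: coboundary_cupr (represents_cocycle xc) (represents_uniq yr yd).
Qed.

Lemma cohomologous_add k (x x' y y' : cech_cocycle k) :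
  cohomologous x x' -> cohomologous y y' ->
  cohomologous (add_cocycle x y) (add_cocycle x' y').
Proof.
move=> /cohomologousP[W [c [oW xc xc']]] /cohomologousP[V [d [oV yd yd']]].
have hl := refine_mapP (@meet_refinesl _ W V).
have hr := refine_mapP (@meet_refinesr _ W V).
apply/cohomologousP; exists (meet_cover W V).
eexists; split; first exact: open_cover_meet.
  exact: represents_add (represents_refine hl xc) (represents_refine hr yd).
exact: represents_add (represents_refine hl xc') (represents_refine hr yd').
Qed.

Lemma cohomologous_cup k l (x x' : cech_cocycle k) (y y' : cech_cocycle l) :
  cohomologous x x' -> cohomologous y y' ->
  cohomologous (cup_cocycle x y) (cup_cocycle x' y').
Proof.
move=> /cohomologousP[W [c [oW xc xc']]] /cohomologousP[V [d [oV yd yd']]].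
have hl := refine_mapP (@meet_refinesl _ W V).
have hr := refine_mapP (@meet_refinesr _ W V).
apply/cohomologousP; exists (meet_cover W V).
eexists; split; first exact: open_cover_meet.
  exact: represents_cup (represents_refine hl xc) (represents_refine hr yd).
exact: represents_cup (represents_refine hl xc') (represents_refine hr yd').
Qed.

Lemma cohomologous_opp k (x x' : cech_cocycle k) :
  cohomologous x x' -> cohomologous (opp_cocycle x) (opp_cocycle x').
Proof.
move=> /cohomologousP[W [c [oW xc xc']]].
by apply/cohomologousP; exists W, (- c); split=> //; exact: represents_opp.
Qed.

Definition cech_zero k : cech k := cech_class (zero_cocycle k).
Definition cech_opp k (u : cech k) : cech k :=
  cech_class (opp_cocycle (generic_quotient.repr u)).
Definition cech_add k (u v : cech k) : cech k :=
  cech_class (add_cocycle (generic_quotient.repr u) (generic_quotient.repr v)).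
Definition cup k l (u : cech k) (v : cech l) : cech (k + l) :=
  cech_class (cup_cocycle (generic_quotient.repr u) (generic_quotient.repr v)).

Lemma repr_class k (x : cech_cocycle k) :
  cohomologous (generic_quotient.repr (cech_class x)) x.
Proof. by apply/cech_classP; rewrite /cech_class reprK. Qed.

Lemma cech_oppE k (x : cech_cocycle k) :
  cech_opp (cech_class x) = cech_class (opp_cocycle x).
Proof. exact/cech_classP/cohomologous_opp/repr_class. Qed.

Lemma cech_addE k (x y : cech_cocycle k) :
  cech_add (cech_class x) (cech_class y) = cech_class (add_cocycle x y).
Proof. by apply/cech_classP/cohomologous_add; exact: repr_class. Qed.

Lemma cupE k l (x : cech_cocycle k) (y : cech_cocycle l) :
  cup (cech_class x) (cech_class y) = cech_class (cup_cocycle x y).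
Proof. by apply/cech_classP/cohomologous_cup; exact: repr_class. Qed.

Lemma cech_addA k : associative (@cech_add k).
Proof.
elim/cech_ind=> x; elim/cech_ind=> y; elim/cech_ind=> z.
rewrite !cech_addE; apply/cech_classP/cohomologousP.
set W := meet_cover (cc_cover x) (meet_cover (cc_cover y) (cc_cover z)).
have [c xc] : exists c, represents W x c.
  by apply: represents_ex; exact: meet_refinesl.
have [d yd] : exists c, represents W y c.
  apply: represents_ex.
  exact: refines_trans (@meet_refinesr _ _ _) (@meet_refinesl _ _ _).
have [e ze] : exists c, represents W z c.
  apply: represents_ex.
  exact: refines_trans (@meet_refinesr _ _ _) (@meet_refinesr _ _ _).
exists W, (c + d + e); split.
- by do ?apply: open_cover_meet; exact: cc_open.
- by rewrite -addrA; do ?apply: represents_add.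
- by do ?apply: represents_add.
Qed.

Lemma cech_addC k : commutative (@cech_add k).
Proof.
elim/cech_ind=> x; elim/cech_ind=> y.
rewrite !cech_addE; apply/cech_classP/cohomologousP.
set W := meet_cover (cc_cover x) (cc_cover y).
have [c xc] : exists c, represents W x c.
  by apply: represents_ex; exact: meet_refinesl.
have [d yd] : exists c, represents W y c.
  by apply: represents_ex; exact: meet_refinesr.
exists W, (c + d); split; first by apply: open_cover_meet; exact: cc_open.
  exact: represents_add.
by rewrite addrC; exact: represents_add.
Qed.

Lemma cech_add0 k : left_id (@cech_zero k) (@cech_add k).
Proof.
elim/cech_ind=> x; rewrite cech_addE; apply/cech_classP/cohomologousP.
have [c xc] := represents_ex (x := x) (W := cc_cover x)
  (fun A UA => ex_intro2 _ _ A UA (fun _ => id)).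
exists (cc_cover x), c; split=> //; first exact: cc_open.
by rewrite -[c]add0r; apply: represents_add => //; exact: represents_zero.
Qed.

Lemma cech_addN k : left_inverse (@cech_zero k) (@cech_opp k) (@cech_add k).
Proof.
elim/cech_ind=> x; rewrite cech_oppE cech_addE; apply/cech_classP/cohomologousP.
have [c xc] := represents_ex (x := x) (W := cc_cover x)
  (fun A UA => ex_intro2 _ _ A UA (fun _ => id)).
exists (cc_cover x), (- c + c); split=> //; first exact: cc_open.
  by apply: represents_add => //; exact: represents_opp.
by rewrite addNr; exact: represents_zero.
Qed.

HB.instance Definition _ k := GRing.isZmodule.Build (cech k)
  (@cech_addA k) (@cech_addC k) (@cech_add0 k) (@cech_addN k).

End CechCohomology.

Definition generates_Z (M : zmodType) (v : M) :=
  bijective (fun m : int => v *~ m).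

(* The degrees 2n and 3n are written so that [cup v1 v1] and [cup v1 v2] have
   the types of [v2] and [v3] definitionally. *)
Definition cohomology_type (X : topologicalType) (a b : int) :=
  exists n : nat, [/\ (0 < n)%N,
    forall k, k \notin [:: 0; n; n + n; n + (n + n)]%N ->
      forall u : cech int X k, u = 0 &
    exists (v0 : cech int X 0) (v1 : cech int X n) (v2 : cech int X (n + n))
           (v3 : cech int X (n + (n + n))),
      [/\ generates_Z v0, generates_Z v1, generates_Z v2 & generates_Z v3] /\
      (cup v1 v1 = v2 *~ a /\ cup v1 v2 = v3 *~ b)].

(* For a finite discrete group, an action is continuous if and only if every
   element acts by a continuous map. *)
Definition continuous_action (gT : finGroupType) (X : topologicalType)
  (to : {action gT &-> X}) := forall g : gT, continuous (to ^~ g).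

Definition isotropy (gT : finGroupType) (X : topologicalType)
  (to : {action gT &-> X}) (x : X) : {set gT} := [set g | to x g == x]%SET.

Definition free_action (gT : finGroupType) (X : topologicalType)
  (to : {action gT &-> X}) := forall x, isotropy to x = 1%g.

(* Main.v *)
Require Import Defs.
From HB Require Import structures.
From mathcomp Require Import all_boot all_order all_algebra all_fingroup.
From mathcomp Require Import all_classical all_reals topology ring zify.

(** Write [g] for the involution given by the generator of the group.  The
    integral cohomology of [X] is free, so modulo 2 it has a basis [1], [x1],
    [x2], [x3] in degrees [0], [n], [2n], [3n], and the parities of [a] and [b]
    give [x1 ^ 2 = x2] and [x1 x2 = 0] ([mod2_cohomology]).

    The cochains of [X] that are invariant under [g] compute the cohomology of
    the orbit space.  With coefficients modulo 2 the map [c |-> c + g c] from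
    all cochains to the invariant ones is surjective, since [g] is free, and its
    kernel consists of the invariant cochains.  Hence a long exact sequence

      H^k(X) --transfer--> H_inv^k --tau--> H_inv^(k+1) --> H^(k+1)(X),

    where [tau] is the product with the characteristic class of the double
    covering ([gysin_shift], [gysin_restriction], [gysin_transfer]).  The powers
    of [tau] vanish eventually, because [X] has a finite-dimensional covering by
    open sets disjoint from their translates ([characteristic_class_nilpotent]).

    If [transfer x1 = 0], then [x1] is the restriction of an invariant class
    [y], and [x2] that of [y ^ 2], so that the transfer vanishes except perhaps
    on [x3].  Then [tau] is injective outside degree [3n], where its kernel
    contains at most one nonzero class.  As [tau] is nilpotent, that kernel is
    all of [H_inv^(3n)]; but this group contains the two distinct nonzero
    classes [tau^(3n) 1] and [tau^(2n) y] ([transfer_generator_nonzero]).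

    If [transfer x1 <> 0], then exactness in low degrees gives
    [transfer x1 = tau^n 1].  Hence [tau^(n+1) 1 = 0], the groups [H_inv^k] with
    [n < k < 2n] vanish, and [x2] is the restriction of a class [y] with
    [tau^n y <> 0].  But [tau^n y = transfer x1 * y] is the transfer of
    [x1 x2 = 0] ([transfer_generator_zero]). *)

Set Implicit Arguments.
Unset Strict Implicit.
Unset Printing Implicit Defensive.

Import Order.TTheory GRing.Theory Num.Theory.
Local Open Scope classical_set_scope.
Local Open Scope ring_scope.

(** * Cochains on sequences of arbitrary vertices *)

Section SeqCochains.
Variable R : comNzRingType.

Section OneVertexType.
Variable T : eqType.
Implicit Types (b c d : seq T -> R) (s t : seq T).

(** The simplicial coboundary, in the recursive form of [delta_cons]; the
    vertices are now of any type, because points of a space and open sets both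
    occur as vertices. *)
Fixpoint bd c s : R :=
  if s is x :: s' then c s' - bd (fun t => c (x :: t)) s' else 0.

Definition cup_at k c d s : R := c (take k.+1 s) * d (drop k s).

Lemma bdD c d s : bd (c + d) s = bd c s + bd d s.
Proof.
elim: s c d => [|x s IH] c d /=; first by rewrite addr0.
have -> : (fun t => (c + d) (x :: t)) =
  (fun t => c (x :: t)) + (fun t => d (x :: t)) by [].
by rewrite IH !fctE; ring.
Qed.

Lemma bdN c s : bd (- c) s = - bd c s.
Proof.
elim: s c => [|x s IH] c /=; first by rewrite oppr0.
have -> : (fun t => (- c) (x :: t)) = - (fun t => c (x :: t)) by [].
by rewrite IH !fctE; ring.
Qed.

Lemma bd0 s : bd 0 s = 0.
Proof. by rewrite -[0](addrN (0 : seq T -> R)) bdD bdN addrN. Qed.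

Lemma bdMn c n s : bd (c *+ n) s = bd c s *+ n.
Proof. by elim: n => [|n IH]; rewrite ?mulr0n ?bd0 // !mulrS bdD IH. Qed.

Lemma bdMz c m s : bd (c *~ m) s = bd c s *~ m.
Proof. by case: m => n; rewrite ?NegzE ?mulrNz ?bdN bdMn. Qed.

Lemma bd_bd c s : bd (bd c) s = 0.
Proof.
elim: s c => [|x s IH] c //=.
have -> : (fun t => c t - bd (fun t0 => c (x :: t0)) t) =
  c - bd (fun t => c (x :: t)) by [].
by rewrite bdD bdN IH subr0 subrr.
Qed.

Lemma eq_bd c d s :
  (forall t, size t = (size s).-1 -> {subset t <= s} -> c t = d t) ->
  bd c s = bd d s.
Proof.
elim: s c d => [//|x s IH] c d /= cd; rewrite cd //; last first.
  by move=> y ys; rewrite inE ys orbT.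
congr (_ - _); case: s IH cd => // y s IH cd.
apply: IH => t st ts; apply: cd => [/=|z]; first by rewrite st.
by rewrite !inE => /orP[->//|/ts]; rewrite inE => ->; rewrite orbT.
Qed.

Lemma bdZ (z : R) c s : bd (fun t => z * c t) s = z * bd c s.
Proof. by elim: s c => [|x s IH] c /=; rewrite ?mulr0 // IH mulrBr. Qed.

Lemma bd_cup k l c d s : size s = (k + l).+2 ->
  bd (cup_at k c d) s =
  cup_at k.+1 (bd c) d s + (-1) ^+ k * cup_at k c (bd d) s.
Proof.
elim: k c s => [|k IH] c [//|x s] /= [ss].
  have -> : (fun t => cup_at 0 c d (x :: t)) =
            (fun t => c [:: x] * d (x :: t)).
    by apply/funext => t; rewrite /cup_at /= take0.
  case: s ss => [//|y s] _.
  by rewrite bdZ /cup_at /= !take0 /=; ring.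
have -> : (fun t => cup_at k.+1 c d (x :: t)) =
  cup_at k (fun t => c (x :: t)) d by [].
by rewrite IH // /cup_at /= exprS; ring.
Qed.

End OneVertexType.

Section VertexMaps.
Variables S T : eqType.
Implicit Types (p q : S -> T) (c d : seq T -> R) (s : seq S).

Lemma bd_map p c s : bd (fun t => c (map p t)) s = bd c (map p s).
Proof.
by elim: s c => [//|x s IH] c /=; rewrite -(IH (fun t => c (p x :: t))).
Qed.

(** The prism operator between two maps of vertices. *)
Fixpoint homotopy p q c s : R :=
  if s is x :: s' then
    c (p x :: q x :: map q s') - homotopy p q (fun t => c (p x :: t)) s'
  else 0.

Lemma homotopyB p q c d s :
  homotopy p q (c - d) s = homotopy p q c s - homotopy p q d s.
Proof.
elim: s c d => [|x s IH] c d /=; first by rewrite subrr.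
have -> : (fun t => (c - d) (p x :: t)) =
          (fun t => c (p x :: t)) - (fun t => d (p x :: t)) by [].
by rewrite IH !fctE; ring.
Qed.

Lemma bd_homotopy p q c s :
  bd (homotopy p q c) s + homotopy p q (bd c) s = c (map q s) - c (map p s).
Proof.
elim: s c => [|x s IH] c /=; first by rewrite addr0 subrr.
have -> : (fun t => c (p x :: q x :: map q t) -
             homotopy p q (fun t0 => c (p x :: t0)) t) =
    (fun t => c (p x :: q x :: map q t)) -
    homotopy p q (fun t => c (p x :: t)) by [].
have -> : (fun t => c t - bd (fun t0 => c (p x :: t0)) t) =
   c - bd (fun t => c (p x :: t)) by [].
rewrite bdD bdN homotopyB (bd_map q (fun t => c (p x :: q x :: t))).
have := IH (fun t => c (p x :: t)).
move: (bd (homotopy p q _) s) => z /(canRL (addrK _)) ->.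
by ring.
Qed.

Lemma homotopy_eq0 p q c s :
  (forall t, size t = (size s).+1 -> {subset t <= map p s ++ map q s} ->
    c t = 0) -> homotopy p q c s = 0.
Proof.
elim: s c => [//|x s IH] c hc /=.
rewrite hc /= ?size_map //; last first.
  move=> y; rewrite !(inE, mem_cat) => /or3P[->//|->|->]; by rewrite ?orbT.
rewrite IH ?subrr // => t st ts; apply: hc; first by rewrite /= st.
move=> y; rewrite !(inE, mem_cat) => /orP[->//|/ts].
by rewrite mem_cat => /orP[] ->; rewrite ?orbT.
Qed.

End VertexMaps.
End SeqCochains.

Lemma delta_bd (R : comNzRingType) (X : topologicalType)
  (c : seq (set X) -> R) s : delta c s = bd c s.
Proof.
by elim: s c => [|A s IH] c; rewrite ?delta_nil // delta_cons IH.
Qed.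

(** * Germs of cochains *)

Section Germs.
Variables (R : comNzRingType) (X : topologicalType).
Implicit Types (b c d : seq X -> R) (s t : seq X) (u v : X -> set X).

Definition nbhd_choice u := forall x, open (u x) /\ u x x.

Lemma nbhd_choiceI u v : nbhd_choice u -> nbhd_choice v ->
  nbhd_choice (fun x => u x `&` v x).
Proof.
by move=> hu hv x; have [? ?] := hu x; have [? ?] := hv x; split=> //;
  apply: openI.
Qed.

(** A germwise property holds on the nerve of some open covering indexed by the
    points of [X], with [x] belonging to the member of index [x].  For such
    coverings refinement is the identity on vertices: a cochain is one function
    on sequences of points, without restriction maps, and a self-map of [X] acts
    on it directly. *)
Definition germwise (P : seq X -> Prop) :=
  exists2 u, nbhd_choice u & forall s z, {in s, forall x, u x z} -> P s.

Lemma germwiseW (P : seq X -> Prop) : (forall s, P s) -> germwise P.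
Proof.
by move=> h; exists (fun=> setT) => // x; split=> //; exact: openT.
Qed.

Lemma germwise_mp2 (P Q S : seq X -> Prop) :
  (forall s, P s -> Q s -> S s) -> germwise P -> germwise Q -> germwise S.
Proof.
move=> h [u hu uP] [v hv vQ]; exists (fun x => u x `&` v x).
  exact: nbhd_choiceI.
by move=> s z sz; apply: h; [apply: (uP s z)|apply: (vQ s z)] => x /sz [].
Qed.

Lemma germwise_mp (P Q : seq X -> Prop) :
  (forall s, P s -> Q s) -> germwise P -> germwise Q.
Proof. by move=> h hP; apply: (germwise_mp2 _ hP hP) => s + _; exact: h. Qed.

Lemma germwise_sub (P : seq X -> Prop) : germwise P ->
  germwise (fun s => forall t, {subset t <= s} -> P t).
Proof.
move=> [u hu uP]; exists u => // s z sz t ts.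
by apply: (uP t z) => x /ts; exact: sz.
Qed.

Lemma germwise_map (f : X -> X) (P : seq X -> Prop) : continuous f ->
  germwise P -> germwise (fun s => P (map f s)).
Proof.
move=> cf [u hu uP]; exists (fun x => f @^-1` u (f x)).
  move=> x; have [ou ux] := hu (f x); split=> //.
  by apply: open_comp ou => y _; exact: cf.
move=> s z sz; apply: (uP _ (f z)) => _ /mapP[x xs ->]; exact: sz.
Qed.

Definition eqg k c d := germwise (fun s => size s = k.+1 -> c s = d s).

Lemma eqg_refl k c : eqg k c c.
Proof. exact: germwiseW. Qed.

Lemma eqgW k c d : (forall s, size s = k.+1 -> c s = d s) -> eqg k c d.
Proof. by move=> h; apply: germwiseW. Qed.

Lemma eqg_sym k c d : eqg k c d -> eqg k d c.
Proof. by apply: germwise_mp => s h /h ->. Qed.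

Lemma eqg_trans k d c b : eqg k c d -> eqg k d b -> eqg k c b.
Proof. by apply: germwise_mp2 => s h h' e; rewrite h ?h'. Qed.

Lemma eqgD k c c' d d' : eqg k c c' -> eqg k d d' -> eqg k (c + d) (c' + d').
Proof. by apply: germwise_mp2 => s h h' e; rewrite !fctE h ?h'. Qed.

Lemma eqgN k c c' : eqg k c c' -> eqg k (- c) (- c').
Proof. by apply: germwise_mp => s h e; rewrite !fctE h. Qed.

Lemma eqg_bd k c d : eqg k c d -> eqg k.+1 (bd c) (bd d).
Proof.
move/germwise_sub; apply: germwise_mp => s h e.
by apply: eq_bd => t st ts; apply: h; rewrite // st e.
Qed.

Lemma eqg_cup k l c c' d d' : eqg k c c' -> eqg l d d' ->
  eqg (k + l) (cup_at k c d) (cup_at k c' d').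
Proof.
move=> /germwise_sub h /germwise_sub h'; apply: germwise_mp2 h h' => s h h' e.
rewrite /cup_at (h (take k.+1 s)) ?(h' (drop k s)) //.
- by move=> x /mem_drop.
- by rewrite size_drop e -addnS addKn.
- by move=> x /mem_take.
- by rewrite size_takel // e ltnS leq_addr.
Qed.

Definition gcocycle k c := eqg k.+1 (bd c) 0.

(** Requiring [b] to vanish on the empty sequence makes the degree 0
    coboundaries zero without a case distinction on the degree. *)
Definition gcobound k c := exists2 b, b [::] = 0 & eqg k c (bd b).

Lemma gcobound0P c : gcobound 0 c <-> eqg 0 c 0.
Proof.
split=> [[b b0 h]|h]; last first.
  by exists 0 => //; apply: eqg_trans h _; apply: eqgW => s _; rewrite bd0.
apply: eqg_trans h _; apply: eqgW; case=> [//|x [|//]] _.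
by rewrite /= b0 subr0.
Qed.

Lemma gcocycle_eq k c d : eqg k c d -> gcocycle k c -> gcocycle k d.
Proof. by move=> /eqg_bd/eqg_sym; exact: eqg_trans. Qed.

Lemma gcobound_eq k c d : eqg k c d -> gcobound k c -> gcobound k d.
Proof. by move=> /eqg_sym h [b b0 h']; exists b => //; exact: eqg_trans h'. Qed.

Lemma eqg_gcobound k c : eqg k c 0 -> gcobound k c.
Proof.
move=> h; exists 0 => //; apply: eqg_trans h _.
by apply: eqgW => s _; rewrite bd0.
Qed.

Lemma gcobound0 k : gcobound k 0.
Proof. exact/eqg_gcobound/eqg_refl. Qed.

Lemma gcoboundD k c d : gcobound k c -> gcobound k d -> gcobound k (c + d).
Proof.
move=> [b b0 h] [b' b'0 h']; exists (b + b').
  by rewrite !fctE b0 b'0 addr0.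
by apply: eqg_trans (eqgD h h') _; apply: eqgW => s _; rewrite bdD.
Qed.

Lemma gcoboundN k c : gcobound k c -> gcobound k (- c).
Proof.
move=> [b b0 h]; exists (- b); first by rewrite !fctE b0 oppr0.
by apply: eqg_trans (eqgN h) _; apply: eqgW => s _; rewrite bdN.
Qed.

Lemma gcoboundB k c d : gcobound k c -> gcobound k d -> gcobound k (c - d).
Proof. by move=> hc hd; apply: gcoboundD hc (gcoboundN hd). Qed.

Lemma gcocycleD k c d : gcocycle k c -> gcocycle k d -> gcocycle k (c + d).
Proof.
by apply: germwise_mp2 => s h h' e; rewrite bdD h ?h' //= addr0.
Qed.

Lemma gcocycleN k c : gcocycle k c -> gcocycle k (- c).
Proof. by apply: germwise_mp => s h e; rewrite bdN h //= oppr0. Qed.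

Lemma gcocycle0 k : gcocycle k 0.
Proof. by apply: eqgW => s _; rewrite bd0. Qed.

Lemma gcocycle_bd k b : gcocycle k (bd b).
Proof. by apply: eqgW => s _; rewrite bd_bd. Qed.

Lemma gcobound_gcocycle k c : gcobound k c -> gcocycle k c.
Proof. by move=> [b _ /eqg_sym h]; apply: gcocycle_eq h (gcocycle_bd _ _). Qed.

Lemma gcocycle_cup k l c d : gcocycle k c -> gcocycle l d ->
  gcocycle (k + l) (cup_at k c d).
Proof.
move=> hc hd; have h1 := eqg_cup hc (eqg_refl l d).
have h2 := eqg_cup (eqg_refl k c) hd; rewrite addnS in h2.
apply: germwise_mp2 h1 h2 => s h1 h2 e; rewrite (bd_cup _ _ e) h1 // h2 //.
by rewrite /cup_at mul0r !mulr0 addr0.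
Qed.

Lemma gcobound_cupl k l c d : gcobound k c -> gcocycle l d ->
  gcobound (k + l) (cup_at k c d).
Proof.
case: k => [|k] hc hd.
  apply: eqg_gcobound.
  apply: eqg_trans (eqg_cup ((gcobound0P c).1 hc) (eqg_refl l d)) _.
  by apply: eqgW => s _; rewrite /cup_at mul0r.
case: hc => b b0 h; exists (cup_at k b d); first by rewrite /cup_at b0 mul0r.
apply: eqg_trans (eqg_cup h (eqg_refl l d)) _.
have h2 := eqg_cup (eqg_refl k b) hd; rewrite addnS in h2.
apply: germwise_mp h2 => s h2 e; rewrite (bd_cup _ _ e) h2 //.
by rewrite {3}/cup_at mulr0 mulr0 addr0.
Qed.

Lemma gcobound_cupr k l c d : gcocycle k c -> gcobound l d ->
  gcobound (k + l) (cup_at k c d).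
Proof.
case: l => [|l] hc hd.
  apply: eqg_gcobound.
  apply: eqg_trans (eqg_cup (eqg_refl k c) ((gcobound0P d).1 hd)) _.
  by apply: eqgW => s _; rewrite /cup_at mulr0.
case: hd => b b0 h; exists (fun s => (-1) ^+ k * cup_at k c b s).
  by rewrite /cup_at b0 !mulr0.
apply: eqg_trans (eqg_cup (eqg_refl k c) h) _; rewrite addnS.
have h2 := eqg_cup hc (eqg_refl l b).
apply: germwise_mp h2 => s h2 e.
rewrite bdZ (bd_cup _ _ e) h2 // [X in _ * (X + _)]/cup_at mul0r add0r mulrA.
by rewrite -expr2 sqrr_sign mul1r.
Qed.

(** Changing the labels of the points within a common carrier changes a cocycle
    by a coboundary; this makes every choice of labels harmless. *)
Lemma gcobound_relabel (Y : eqType) (carrier : Y -> set X) (p q : X -> Y) v k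
    (c : seq Y -> R) :
  nbhd_choice v ->
  (forall x z, v x z -> carrier (p x) z /\ carrier (q x) z) ->
  (forall (r : seq Y) z, size r = k.+2 -> {in r, forall y, carrier y z} ->
    bd c r = 0) ->
  gcobound k (fun s => c (map q s) - c (map p s)).
Proof.
move=> hv pq hc; exists (homotopy p q c) => //; exists v => // s z sz e.
rewrite -bd_homotopy (homotopy_eq0 (s := s)) ?addr0 // => t st ts.
apply: (hc t z); first by rewrite st e.
move=> y /ts; rewrite mem_cat => /orP[] /mapP[x xs ->];
  by have [] := pq x z (sz _ xs).
Qed.

End Germs.

(** * Cech classes as germs *)

Section CechGerms.
Variables (R : comNzRingType) (X : topologicalType).
Implicit Types (U W : set (set X)) (f : seq (set X) -> R) (c d : seq X -> R).
Implicit Types (al be : X -> set X).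

Definition picks U al := forall x, U (al x) /\ al x x.

Lemma picks_ex U : open_cover U -> exists al, picks U al.
Proof.
move=> [_ cU]; have h x : exists A, U A /\ A x.
  have [A UA Ax] : (\bigcup_(A in U) A) x by rewrite cU.
  by exists A.
by have [al hal] := choice h; exists al.
Qed.

Lemma picks_nbhd U al : open_cover U -> picks U al -> nbhd_choice al.
Proof. by move=> [oU _] h x; have [/oU] := h x. Qed.

Lemma picks_refining W U p al : refining_map W U p -> picks W al ->
  picks U (p \o al).
Proof. by move=> hp h x; have [/hp[? sub] /sub] := h x. Qed.

Lemma picks_nerve U al k s z : picks U al -> size s = k.+1 ->
  {in s, forall x, al x z} -> nerve U k (map al s).
Proof.
move=> h e sz; split; first by rewrite size_map.
  by move=> _ /mapP[x _ ->]; have [] := h x.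
by exists z => _ /= /mapP[x xs ->]; exact: sz.
Qed.

Lemma gcoboundS k c (b : seq X -> R) :
  eqg k.+1 c (bd b) -> gcobound k.+1 c.
Proof.
move=> h; exists (fun s => if s is [::] then 0 else b s) => //.
apply: eqg_trans h _; apply: eqgW => s e; apply: eq_bd => t.
by rewrite e; case: t.
Qed.

Lemma gcobound_coboundary W be k f : open_cover W -> picks W be ->
  coboundary W k f -> gcobound k (fun s => f (map be s)).
Proof.
move=> oW h; case: k => [|k] /=.
  move=> f0; apply: eqg_gcobound; exists be; first exact: picks_nbhd h.
  by move=> s z sz e; rewrite f0 //; exact: picks_nerve sz.
move=> [b fb]; apply: (@gcoboundS k _ (fun s => b (map be s))); exists be.
  exact: picks_nbhd h.
move=> s z sz e; rewrite fb; last exact: picks_nerve sz.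
by rewrite delta_bd bd_map.
Qed.

Lemma gcocycle_picks U al k f : open_cover U -> picks U al -> cocycle U k f ->
  gcocycle k (fun s => f (map al s)).
Proof.
move=> oU h hf; exists al; first exact: picks_nbhd h.
by move=> s z sz e; rewrite bd_map -delta_bd hf //; exact: picks_nerve sz.
Qed.

Lemma gcobound_picks U al be k f : open_cover U -> picks U al -> picks U be ->
  cocycle U k f -> gcobound k (fun s => f (map be s) - f (map al s)).
Proof.
move=> oU ha hb hf.
apply: (gcobound_relabel (carrier := fun A z => U A /\ A z)
  (v := fun x => al x `&` be x)).
- by apply: nbhd_choiceI; exact: (picks_nbhd oU).
- by move=> x z []; have [? _] := ha x; have [? _] := hb x.
- move=> r z e rz; rewrite -delta_bd hf //; split=> // [A Ar|].
    by have [] := rz A Ar.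
  by exists z => A /= Ar; have [] := rz A Ar.
Qed.

Lemma coboundary_delta W k f b : b [::] = 0 ->
  (forall s, nerve W k s -> f s = delta b s) -> coboundary W k f.
Proof.
case: k => [|k] b0 h /=; last by exists b.
move=> s ns; rewrite h // delta_bd; case: ns => + _ _.
by case: s => [|A [|]] //= _; rewrite b0 subr0.
Qed.

(** A relation rather than a map, since the germ of a class depends on the
    picks.  Modulo coboundaries it is a bijection ([germ_of_ex],
    [germ_of_uniq], [germ_of_inj]) that respects sums and cup products. *)
Definition germ_of k (u : cech R X k) c :=
  exists x al, [/\ cech_class x = u, picks (cc_cover x) al
    & gcobound k (c - (fun s => x (map al s)))].

Lemma germ_of_eq k (u : cech R X k) c d :
  germ_of u c -> gcobound k (d - c) -> germ_of u d.
Proof.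
move=> [x [al [xu ha hc]]] dc; exists x, al; split=> //.
have -> : d - (fun s => x (map al s)) = (d - c) + (c - fun s => x (map al s)).
  by rewrite addrA subrK.
exact: gcoboundD.
Qed.

Lemma germ_of_represents k (x : cech_cocycle R X k) W f be :
  open_cover W -> represents W x f -> picks W be ->
  germ_of (cech_class x) (fun s => f (map be s)).
Proof.
move=> oW [p hp h] hb; exists x, (p \o be); split=> //.
  exact: picks_refining hb.
have := gcoboundN (gcobound_coboundary oW hb h); apply: gcobound_eq.
apply: eqgW => s _; rewrite !fctE /pullback /= -map_comp /=.
by ring.
Qed.

Lemma germ_of_uniq k (u : cech R X k) c d :
  germ_of u c -> germ_of u d -> gcobound k (c - d).
Proof.
move=> [x [al [xu ha hc]]] [y [be [yu hb hd]]].
have /cech_classP[W [p [q [oW hp hq h]]]] : cech_class x = cech_class y.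
  by rewrite xu.
have [ga hg] := picks_ex oW.
have h0 := gcobound_coboundary oW hg h.
have h1 := gcobound_picks (cc_open x) ha (picks_refining hp hg)
  (cc_cocycle (c := x)).
have h2 := gcobound_picks (cc_open y) hb (picks_refining hq hg)
  (cc_cocycle (c := y)).
have := gcoboundB (gcoboundD (gcoboundB hc hd) h0) (gcoboundB h1 h2).
apply: gcobound_eq; apply: eqgW => s _.
by rewrite !fctE /pullback /= -!map_comp /=; ring.
Qed.

Lemma germ_of_cocycle k (u : cech R X k) :
  exists2 c, gcocycle k c & germ_of u c.
Proof.
elim/cech_ind: u => x; have [al hal] := picks_ex (cc_open x).
exists (fun s => x (map al s)).
  exact: gcocycle_picks (cc_open x) hal (cc_cocycle (c := x)).
by exists x, al; split=> //; rewrite subrr; exact: gcobound0.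
Qed.

Lemma germ_of0 k : germ_of (0 : cech R X k) 0.
Proof.
exists (zero_cocycle R X k), (fun=> setT); split=> //.
apply: gcobound_eq (gcobound0 _ _ _); apply: eqgW => s _.
by rewrite !fctE subr0.
Qed.

Lemma germ_of_common k l (u : cech R X k) (v : cech R X l) c d :
  germ_of u c -> germ_of v d -> exists x y W f g be,
   [/\ cech_class x = u, cech_class y = v, open_cover W & picks W be] /\
   [/\ represents W x f, represents W y g,
     gcobound k (c - (fun s => f (map be s)))
     & gcobound l (d - (fun s => g (map be s)))].
Proof.
move=> uc vd; have [x [al [xu _ _]]] := uc; have [y [al' [yv _ _]]] := vd.
have [f xf] := represents_ex (@meet_refinesl _ (cc_cover x) (cc_cover y)).
have [g yg] := represents_ex (@meet_refinesr _ (cc_cover x) (cc_cover y)).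
have oW := open_cover_meet (cc_open x) (cc_open y).
have [be hb] := picks_ex oW.
exists x, y, (meet_cover (cc_cover x) (cc_cover y)), f, g, be.
do 2?[split=> //]; last 2 first.
- apply: germ_of_uniq uc _; rewrite -xu; exact: germ_of_represents hb.
- apply: germ_of_uniq vd _; rewrite -yv; exact: germ_of_represents hb.
Qed.

Lemma germ_ofD k (u v : cech R X k) c d :
  germ_of u c -> germ_of v d -> germ_of (u + v) (c + d).
Proof.
move=> uc vd; have [x [y [W [f [g [be [[xu yv oW hb] [xf yg hc hd]]]]]]]] :=
  germ_of_common uc vd.
have -> : u + v = cech_class (add_cocycle x y) by rewrite -cech_addE xu yv.
apply: germ_of_eq (germ_of_represents oW (represents_add xf yg) hb) _.
apply: gcobound_eq (gcoboundD hc hd); apply: eqgW => s _.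
by rewrite !fctE; ring.
Qed.

Lemma germ_of_cup k l (u : cech R X k) (v : cech R X l) c d :
  germ_of u c -> germ_of v d -> gcocycle k c -> gcocycle l d ->
  germ_of (cup u v) (cup_at k c d).
Proof.
move=> uc vd Zc Zd.
have [x [y [W [f [g [be [[xu yv oW hb] [xf yg hc hd]]]]]]]] :=
  germ_of_common uc vd.
have -> : cup u v = cech_class (cup_cocycle x y) by rewrite -cupE xu yv.
apply: germ_of_eq (germ_of_represents oW (represents_cup xf yg) hb) _.
have Zg : gcocycle l (fun s => g (map be s)).
  have := gcocycleD Zd (gcocycleN (gcobound_gcocycle hd)).
  by apply: gcocycle_eq; apply: eqgW => s _; rewrite !fctE; ring.
have := gcoboundD (gcobound_cupr Zc hd) (gcobound_cupl hc Zg).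
apply: gcobound_eq; apply: eqgW => s _.
by rewrite !fctE /cup_at /cup_cochain map_take map_drop; ring.
Qed.

Lemma germ_ofN k (u : cech R X k) c : germ_of u c -> germ_of (- u) (- c).
Proof.
move=> uc; have [x [al [xu ha hc]]] := uc.
have oU := cc_open x.
have xx : represents (cc_cover x) x x.
  exists id; first by move=> A UA; split.
  apply: coboundary_eq (coboundary0 _ _) => s _.
  by rewrite !fctE /pullback /= map_id subrr.
have -> : - u = cech_class (opp_cocycle x) by rewrite -cech_oppE xu.
apply: germ_of_eq (germ_of_represents oU (represents_opp xx) ha) _.
apply: gcobound_eq (gcoboundN hc); apply: eqgW => s _.
by rewrite !fctE; ring.
Qed.

Lemma germ_ofMz k (u : cech R X k) c m :
  germ_of u c -> germ_of (u *~ m) (c *~ m).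
Proof.
move=> uc; have hn n : germ_of (u *+ n) (c *+ n).
  elim: n => [|n IH]; rewrite ?mulr0n; first exact: germ_of0.
  by rewrite !mulrS; exact: germ_ofD.
case: m => n; first exact: hn.
by rewrite NegzE !mulrNz; exact/germ_ofN/hn.
Qed.

Section NamedMembers.
Variable x0 : X.

(** The members of a neighbourhood choice form an open covering, whose nerve
    maps to the linked sequences once each member is named by a point. *)
Lemma nbhd_choice_cover u : nbhd_choice u ->
  open_cover (range u) /\ exists2 io : set X -> X,
    forall x, u (io (u x)) = u x &
    forall k s, nerve (range u) k s ->
      exists z, {in map io s, forall x, u x z}.
Proof.
move=> hu; split.
  split=> [_ [x _ <-]|]; first by have [] := hu x.
  apply/seteqP; split=> // x _; exists (u x); first by exists x.
  by have [] := hu x.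
pose io A := xget x0 [set x | u x = A].
have uio x : u (io (u x)) = u x.
  by rewrite /io; case: xgetP => [y _ //|nox]; case: (nox x).
exists io => // k s [_ su [z sz]]; exists z => _ /mapP[A As ->].
by have [y _ yA] := su _ As; rewrite -yA uio yA; exact: sz.
Qed.

Lemma germ_of_ex k c : gcocycle k c -> exists u : cech R X k, germ_of u c.
Proof.
move=> [u hu hc]; have [oU [io uio hio]] := nbhd_choice_cover hu.
have Zc : cocycle (range u) k (fun s => c (map io s)).
  move=> s ns; rewrite delta_bd bd_map; have [z sz] := hio _ _ ns.
  by rewrite (hc _ _ sz) // size_map; case: ns.
exists (cech_class (CechCocycle oU Zc)), (CechCocycle oU Zc), u; split=> //.
  by move=> x; have [_ ?] := hu x; split => //; exists x.
have h : gcobound k (fun s => c (map id s) - c (map (io \o u) s)).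
  apply: (gcobound_relabel (carrier := u) hu) => [x z uxz|r z e rz].
    by rewrite /= uio.
  exact: (hc r z).
apply: gcobound_eq h; apply: eqgW => s _.
by rewrite !fctE map_id /= -map_comp.
Qed.

Lemma germ_of_inj k (u : cech R X k) c :
  germ_of u c -> gcobound k c -> u = 0.
Proof.
move=> [x [al [<- ha hc]]] hc'.
have [b b0 [v hv hb]] : gcobound k (fun s => x (map al s)).
  have := gcoboundB hc' hc; apply: gcobound_eq; apply: eqgW => s _.
  by rewrite !fctE; ring.
pose u' y := v y `&` al y.
have hu' : nbhd_choice u'.
  by apply: nbhd_choiceI => //; apply: picks_nbhd ha; exact: cc_open.
have [oU [io uio hio]] := nbhd_choice_cover hu'.
apply/cech_classP; exists (range u'), (al \o io), (fun=> setT).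
split=> //.
  move=> _ [y _ <-] /=; have [? _] := ha (io (u' y)); split=> //.
  by rewrite -{1}uio => z [].
apply: (coboundary_delta (b := fun s => b (map io s))) => // s ns.
rewrite !fctE /pullback /= subr0 delta_bd bd_map map_comp.
have [z sz] := hio _ _ ns; rewrite (hb _ z) //; first by move=> y /sz[].
by rewrite size_map; case: ns.
Qed.

End NamedMembers.
End CechGerms.

(** * Reduction modulo 2 *)

Section ModTwo.
Variable X : topologicalType.
Implicit Types (c d : seq X -> int) (e : seq X -> bool).

Definition red c : seq X -> bool := fun s => (c s)%:~R.

(** The unit vanishes on the empty sequence so as to be [invariant] below. *)
Definition unit_cochain : seq X -> bool := fun s => s != [::].

Lemma bd_red c s : bd (red c) s = (bd c s)%:~R.
Proof.
elim: s c => [//|x s IH] c /=.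
by rewrite (IH (fun t => c (x :: t))) rmorphB.
Qed.

Lemma intr_boolM2 (m : int) : ((m * 2)%:~R : bool) = 0.
Proof. by rewrite intrM mulr0. Qed.

Lemma intr_bool_eq0 (m : int) : (m%:~R : bool) = 0 -> exists q, m = q * 2.
Proof.
move=> m0; exists (m %/ 2)%Z; rewrite {1}(divz_eq m 2).
move: m0; rewrite {1}(divz_eq m 2) intrD intr_boolM2 add0r.
have : 0 <= (m %% 2)%Z < 2 by rewrite modz_ge0 // ltz_pmod.
by case: (m %% 2)%Z => [[|[|]]|] //= _ _; rewrite addr0.
Qed.

Lemma intr_bool (m : int) : (m%:~R : bool) = ~~ (2 %| m)%Z.
Proof.
case: (boolP (2 %| m)%Z) => [/dvdzP[q ->]|]; first exact: intr_boolM2.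
apply: contraNeq => m0; apply/dvdzP.
by apply: intr_bool_eq0; move: m0; case: (m%:~R : bool).
Qed.

Lemma mulrz_bool (y : bool) (m : int) : y *~ m = y && (m%:~R : bool).
Proof. by rewrite -mulrzl mulrC. Qed.

Lemma red_gcobound k c : gcobound k c -> gcobound k (red c).
Proof.
move=> [b b0 h]; exists (red b); first by rewrite /red b0.
by apply: germwise_mp h => s h e; rewrite bd_red -h.
Qed.

Lemma red_gcocycle k c : gcocycle k c -> gcocycle k (red c).
Proof. by apply: germwise_mp => s h e; rewrite bd_red h. Qed.

Lemma mulrz_at c (m : int) s : (c *~ m) s = c s *~ m.
Proof.
have hn n : (c *+ n) s = c s *+ n.
  by elim: n => [|n IH]; rewrite ?mulr0n // !mulrS fctE IH.
case: m => n; first exact: hn.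
by rewrite NegzE !mulrNz !fctE; congr (- _); exact: hn.
Qed.

Lemma red_mulz c (m : int) s : red (c *~ m) s = red c s && (m%:~R : bool).
Proof. by rewrite /red mulrz_at raddfMz mulrz_bool. Qed.

Lemma red_sub c d s : red (c - d) s = red c s - red d s.
Proof. by rewrite /red !fctE rmorphB. Qed.

Lemma mulr2z_at c s : (c *~ 2) s = c s * 2.
Proof. by rewrite mulrz_at -[in LHS]mulrzr. Qed.

Hypothesis torsion_free :
  forall k (u : cech int X k), u *~ 2 = 0 -> u = 0.

Variable x0 : X.

(** The Bockstein argument: the coboundary of an integral lift is twice a
    cocycle, whose class is 2-torsion; hence the lift can be corrected to a
    cocycle. *)
Lemma red_lift k e : gcocycle k e ->
  exists2 c, gcocycle k c & forall s, red c s = e s.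
Proof.
move=> he; pose l : seq X -> int := fun s => (e s : nat).
have rl s : red l s = e s by rewrite /red /l; case: (e s).
pose h : seq X -> int := fun s => (bd l s %/ 2)%Z.
have hl : eqg k.+1 (h *~ 2) (bd l).
  apply: germwise_mp he => s es ss.
  have /intr_bool_eq0[q hq] : ((bd l s)%:~R : bool) = 0.
    by rewrite -bd_red (_ : red l = e) ?es //; apply/funext.
  by rewrite mulr2z_at /h hq mulzK //.
have Zh : gcocycle k.+1 h.
  have := gcocycle_eq (eqg_sym hl) (gcocycle_bd _ l).
  apply: germwise_mp => s + ss => /(_ ss); rewrite bdMz => /eqP.
  by rewrite mulrz_eq0 => /eqP.
have [w wh] := germ_of_ex x0 Zh.
have w0 : w = 0.
  apply: torsion_free; apply: germ_of_inj (germ_ofMz 2 wh) _ => //.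
  by apply: gcobound_eq (eqg_sym hl) _; apply: gcoboundS (eqg_refl _ _).
have [f f0 hf] : gcobound k.+1 h.
  have := germ_of_uniq wh (_ : germ_of w 0).
  by rewrite subr0; apply; rewrite w0; exact: germ_of0.
exists (l - f *~ 2); last first.
  by move=> s; rewrite /red !fctE rmorphB /=; have := red_mulz f 2 s;
    rewrite /red => ->; rewrite andbF subr0 -[RHS]rl.
apply: germwise_mp2 hl hf => s h1 h2 ss.
by rewrite bdD bdN bdMz -h2 // -h1 //; exact: subrr.
Qed.

(** With coefficients modulo 2 the multiples of [x] are [0] and [x]. *)
Definition spans k (x : seq X -> bool) := gcocycle k x /\
  forall e, gcocycle k e -> gcobound k e \/ gcobound k (e + x).

Lemma red_spans k (v : cech int X k) c :
  (forall u, exists m, u = v *~ m) -> germ_of v c -> gcocycle k c ->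
  spans k (red c).
Proof.
move=> gen vc Zc; split=> [|e /red_lift[d Zd de]]; first exact: red_gcocycle.
have [u ud] := germ_of_ex x0 Zd; have [m um] := gen u.
have h : gcobound k (red (d - c *~ m)).
  by apply/red_gcobound/(germ_of_uniq ud); rewrite um; exact: germ_ofMz.
have E s : red (d - c *~ m) s = e s - (red c s && (m%:~R : bool)).
  by rewrite -de -red_mulz /red !fctE rmorphB.
case: (boolP (m%:~R : bool)) E => _ E; [right|left];
  apply: gcobound_eq h; apply: eqgW => s _; rewrite E ?fctE ?andbT //.
by rewrite andbF subr0.
Qed.

(** If the reduction of a generator [v] bounded, correcting its cocycle by the
    coboundary of a lift would make [v] divisible by 2. *)
Lemma red_nontrivial k (v : cech int X k) c :
  generates_Z v -> germ_of v c -> gcocycle k c -> ~ gcobound k (red c).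
Proof.
move=> [deg vK degK] vc Zc [b b0 h].
pose l : seq X -> int := fun s => (b s : nat).
have rl : red l = b by apply/funext => s; rewrite /red /l; case: (b s).
pose f : seq X -> int := fun s => ((c s - bd l s) %/ 2)%Z.
have hf : eqg k (f *~ 2) (c - bd l).
  apply: germwise_mp h => s cs ss.
  have /intr_bool_eq0[q hq] : ((c s - bd l s)%:~R : bool) = 0.
    by rewrite rmorphB /= -bd_red rl -cs // subrr.
  by rewrite mulr2z_at /f hq mulzK.
have Zf : gcocycle k f.
  have := gcocycle_eq (eqg_sym hf) (gcocycleD Zc (gcocycleN (gcocycle_bd _ l))).
  apply: germwise_mp => s + ss => /(_ ss); rewrite bdMz => /eqP.
  by rewrite mulrz_eq0 => /eqP.
have [w wf] := germ_of_ex x0 Zf.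
have vw : v = w *~ 2.
  apply/eqP; rewrite -subr_eq0; apply/eqP.
  apply: (germ_of_inj x0 (germ_ofD vc (germ_ofN (germ_ofMz 2 wf)))).
  have Bl : gcobound k (bd l).
    by exists l => //; [rewrite /l b0|exact: eqg_refl].
  apply: gcobound_eq Bl; apply: germwise_mp hf => s hs ss.
  by rewrite !fctE hs // !fctE; ring.
have := vK 1; rewrite mulr1z {1}vw -(degK w) -mulrzA vK.
by case: (deg w) => [[|n]|n].
Qed.

End ModTwo.

Lemma generates_Z_torsion_free (M : zmodType) (v u : M) :
  generates_Z v -> u *~ 2 = 0 -> u = 0.
Proof.
move=> [deg vK degK]; rewrite -[u]degK -mulrzA -(mulr0z v).
by move/(can_inj vK)/eqP; rewrite mulf_eq0 orbF => /eqP ->.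
Qed.

Lemma mod2_cohomology (X : topologicalType) (x0 : X) (a b : int) :
  cohomology_type X a b -> ~~ (2 %| a)%Z -> (2 %| b)%Z ->
  exists n (x1 x2 x3 : seq X -> bool), (0 < n)%N /\
  [/\ forall k, k \notin [:: 0; n; n + n; n + (n + n)]%N ->
        forall e : seq X -> bool, gcocycle k e -> gcobound k e,
     spans 0 (@unit_cochain X) /\ ~ gcobound 0 (@unit_cochain X),
     spans n x1 /\ ~ gcobound n x1,
     spans (n + n) x2 /\ ~ gcobound (n + n) x2 &
     [/\ spans (n + (n + n)) x3, gcobound (n + n) (cup_at n x1 x1 + x2)
      & gcobound (n + (n + n)) (cup_at n x1 x2)]].
Proof.
move=> [n [n0 vanish [v0 [v1 [v2 [v3 [[g0 g1 g2 g3] [v11 v12]]]]]]]].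
move=> a_odd b_even.
have tf k (u : cech int X k) : u *~ 2 = 0 -> u = 0.
  case: (boolP (k \in [:: 0; n; n + n; n + (n + n)]%N)); last first.
    by move=> /vanish h _; exact: h.
  rewrite !inE => /or4P[] /eqP ?; subst k.
  - exact: generates_Z_torsion_free g0.
  - exact: generates_Z_torsion_free g1.
  - exact: generates_Z_torsion_free g2.
  - exact: generates_Z_torsion_free g3.
have dim1 k (v : cech int X k) : generates_Z v -> exists c,
    [/\ gcocycle k c, germ_of v c, spans k (red c) & ~ gcobound k (red c)].
  move=> gv; have [c Zc vc] := germ_of_cocycle v; exists c; split=> //.
    apply: (red_spans tf x0 _ vc Zc) => u.
    by case: gv => deg _ degK; exists (deg u).
  exact: (red_nontrivial x0 gv vc Zc).
have [c0 [Z0 h0 s0 t0]] := dim1 _ _ g0.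
have [c1 [Z1 h1 s1 t1]] := dim1 _ _ g1.
have [c2 [Z2 h2 s2 t2]] := dim1 _ _ g2.
have [c3 [Z3 h3 s3 t3]] := dim1 _ _ g3.
exists n, (red c1), (red c2), (red c3); split=> //; split=> //.
- move=> k nk e he; have u0 u : exists m : int, u = (0 : cech int X k) *~ m.
    by exists 0; rewrite (vanish _ nk u).
  have [_ /(_ e he)[//|]] :=
    red_spans tf x0 u0 (germ_of0 _ X k) (gcocycle0 _ X k).
  by apply: gcobound_eq; apply: eqgW => s _; rewrite fctE; exact: addr0.
- have one_cocycle : gcocycle 0 (@unit_cochain X).
    by apply: eqgW => -[|? [|? []]].
  have one_neq0 : ~ gcobound 0 (@unit_cochain X).
    move=> /gcobound0P[u hu h]; have [_ ux] := hu x0.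
    suff : true = 0 :> bool by [].
    by apply: (h [:: x0] x0) => // y; rewrite inE => /eqP ->.
  split=> //; split=> // e he.
  have [_ h] := s0; have [//|h1c] := h _ one_cocycle.
  have [|hec] := h _ he; [by left|right].
  apply: gcobound_eq (gcoboundB hec h1c); apply: eqgW => s _.
  by rewrite !fctE; case: (e s); case: (red c0 s); case: (unit_cochain s).
split=> //.
- have : gcobound (n + n) (red (cup_at n c1 c1 - c2 *~ a)).
    apply/red_gcobound/(germ_of_uniq (germ_of_cup h1 h1 Z1 Z1)).
    by rewrite v11; exact: germ_ofMz.
  apply: gcobound_eq; apply: eqgW => s _; rewrite red_sub red_mulz intr_bool.
  by rewrite a_odd andbT /red /cup_at intrM.
- have : gcobound (n + (n + n)) (red (cup_at n c1 c2 - c3 *~ b)).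
    apply/red_gcobound/(germ_of_uniq (germ_of_cup h1 h2 Z1 Z2)).
    by rewrite v12; exact: germ_ofMz.
  apply: gcobound_eq; apply: eqgW => s _; rewrite red_sub red_mulz intr_bool.
  by rewrite b_even andbF subr0 /red /cup_at intrM.
Qed.

(** * The Smith-Gysin sequence of a free involution *)

(** In each orbit of two points, exactly the chosen representative is marked. *)
Lemma involution_marking (T : choiceType) (f : T -> T) : involutive f ->
  exists m : T -> bool, forall x, f x <> x -> m (f x) = ~~ m x.
Proof.
move=> ff; pose r x := xget x [set y | y = x \/ y = f x].
have rP x : r x = x \/ r x = f x.
  by rewrite /r; case: xgetP => [y _ //|nox]; case: (nox x); left.
have rf x : r (f x) = r x.
  rewrite /r (_ : [set y | y = f x \/ y = f (f x)] =
    [set y | y = x \/ y = f x]).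
    rewrite /xget; case: pselect => // -[]; exists x.
    by apply/asboolP; left.
  by apply/seteqP; split=> y /=; rewrite ff => -[]; [right|left|right|left].
exists (fun x => r x == x) => x fx; rewrite rf.
case: (rP x) => ->; rewrite ?eqxx; first by apply/eqP => /esym.
by apply/esym/negbT/eqP.
Qed.

Section Involution.
Variables (X : topologicalType) (g : X -> X).
Hypotheses (gcont : continuous g) (gg : involutive g).
Implicit Types (b c d e : seq X -> bool) (s t : seq X) (w : seq X -> bool).

Let map_gg s : map g (map g s) = s.
Proof. by rewrite -map_comp (eq_map (g := id)) ?map_id // => x; exact: gg. Qed.

Lemma addcc c : c + c = 0.
Proof. by apply/funext => s; rewrite !fctE; exact: addbb. Qed.

Definition pullg c : seq X -> bool := fun s => c (map g s).

Lemma eqg_pullg k c d : eqg k c d -> eqg k (pullg c) (pullg d).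
Proof.
move=> /(germwise_map gcont); apply: germwise_mp => s h e.
by apply: h; rewrite size_map.
Qed.

(** The empty sequence is the only one fixed by [g]; the vanishing there makes
    the action free on all sequences that matter. *)
Definition invariant c := c [::] = 0 /\ pullg c = c.

Definition equivariant w := forall s, s != [::] -> w (map g s) = ~~ w s.

Definition scale w c : seq X -> bool := fun s => w s * c s.

Definition transfer c := c + pullg c.

(** If [w s] only depends on the first point of [s] by a marking [phi], this is
    the cup product with the cocycle [phi x + phi y] of the double covering.
    As a commutator with [bd] it commutes with [bd] for every [w], and this
    freedom in [w] is what the nilpotence below rests on. *)
Definition shift w c := bd (scale w c) + scale w (bd c).

Definition inv_cocycle k c := invariant c /\ gcocycle k c.

(** The primitive has to be invariant as well: this is the coboundary relation
    of the complex of invariant cochains. *)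
Definition inv_cobound k c := exists2 b, invariant b & eqg k c (bd b).

Lemma bd_pullg c : bd (pullg c) = pullg (bd c).
Proof. by apply/funext => s; rewrite /pullg bd_map. Qed.

Lemma invariantD c d : invariant c -> invariant d -> invariant (c + d).
Proof.
move=> [c0 ci] [d0 di]; split; first by rewrite !fctE c0 d0 addr0.
by rewrite -{2}ci -{2}di.
Qed.

Lemma invariant_cup k c d : invariant c -> invariant d ->
  invariant (cup_at k c d).
Proof.
move=> [c0 ci] [d0 di]; split; first by rewrite /cup_at c0 mul0r.
by apply/funext => s; rewrite /pullg /cup_at -map_take -map_drop -{2}ci -{2}di.
Qed.

Lemma pullg_scale w c : equivariant w -> c [::] = 0 ->
  pullg (scale w c) = scale w (pullg c) + pullg c.
Proof.
move=> hw c0; apply/funext => -[|x s]; rewrite /pullg /scale !fctE /=.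
  by rewrite c0 !mulr0 addr0.
by rewrite (hw (x :: s)) //=; case: (w _); case: (c _).
Qed.

Lemma invariant_transfer c : invariant (transfer c).
Proof.
split; first by rewrite /transfer !fctE /pullg; exact: addbb.
apply/funext => s; rewrite /transfer /pullg !fctE map_gg; exact: addrC.
Qed.

Lemma transfer_scale w c : equivariant w -> invariant c ->
  transfer (scale w c) = c.
Proof.
move=> hw [c0 ci]; rewrite /transfer pullg_scale // ci addrA addcc.
exact: add0r.
Qed.

Lemma transfer_bd c : transfer (bd c) = bd (transfer c).
Proof. by apply/funext => s; rewrite /transfer -bd_pullg !fctE bdD. Qed.

Lemma transfer_invariant c : invariant c -> transfer c = 0.
Proof. by move=> [_ ci]; rewrite /transfer ci; exact: addcc. Qed.

Lemma transferD c d : transfer (c + d) = transfer c + transfer d.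
Proof. by apply/funext => s; rewrite /transfer /pullg !fctE addrACA. Qed.

Lemma eqg_transfer k c d : eqg k c d -> eqg k (transfer c) (transfer d).
Proof. by move=> h; apply: eqgD => //; exact: eqg_pullg. Qed.

(** Every cochain is the sum of an invariant one and of [w] times an invariant
    one: the short exact sequence behind the Gysin sequence is split by [w]. *)
Lemma invariant_split w c : equivariant w -> c [::] = 0 ->
  invariant (c + scale w (transfer c)).
Proof.
move=> hw c0; have [t0 ti] := invariant_transfer c.
split; first by rewrite !fctE /scale c0 t0 mulr0 addr0.
have -> : pullg (c + scale w (transfer c)) =
  pullg c + pullg (scale w (transfer c)) by [].
rewrite pullg_scale // ti addrCA addrC; congr (_ + _).
by rewrite /transfer addrCA addcc addr0.
Qed.

Lemma eqg_scale k w c d : eqg k c d -> eqg k (scale w c) (scale w d).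
Proof. by apply: germwise_mp => s h e; rewrite /scale h. Qed.

Lemma eqg_shift k w c d : eqg k c d -> eqg k.+1 (shift w c) (shift w d).
Proof.
move=> h; apply: eqgD; first exact/eqg_bd/eqg_scale.
exact/eqg_scale/eqg_bd.
Qed.

Lemma shiftD w c d : shift w (c + d) = shift w c + shift w d.
Proof.
have scaleD c' d' : scale w (c' + d') = scale w c' + scale w d'.
  by apply/funext => s; rewrite /scale !fctE mulrDr.
have bdD' c' d' : bd (c' + d') = bd c' + bd d'.
  by apply/funext => s; rewrite bdD.
by rewrite /shift bdD' !scaleD bdD' addrACA.
Qed.

Lemma shift_nil w c : shift w c [::] = 0.
Proof. by rewrite /shift !fctE /scale /= mulr0 addr0. Qed.

Lemma invariant_shift w c : equivariant w -> invariant c ->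
  invariant (shift w c).
Proof.
move=> hw [c0 ci]; split; first exact: shift_nil.
have -> : pullg (shift w c) = bd (pullg (scale w c)) + pullg (scale w (bd c)).
  by rewrite bd_pullg.
rewrite !pullg_scale // -bd_pullg ci /shift.
have -> : bd (scale w c + c) = bd (scale w c) + bd c.
  by apply/funext => s; rewrite bdD.
by rewrite addrACA addcc addr0.
Qed.

Lemma shift_cocycle k w c : gcocycle k c ->
  eqg k.+1 (shift w c) (bd (scale w c)).
Proof.
move=> h; rewrite -[X in eqg _ _ X]addr0; apply: eqgD (eqg_refl _ _) _.
apply: eqg_trans (eqg_scale w h) _.
by apply: eqgW => s _; rewrite /scale mulr0.
Qed.

Lemma shift_gcobound k w c : gcocycle k c -> gcobound k.+1 (shift w c).
Proof. by move=> h; apply: gcoboundS (shift_cocycle w h). Qed.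

Lemma inv_cocycle_shift k w c : equivariant w -> inv_cocycle k c ->
  inv_cocycle k.+1 (shift w c).
Proof.
move=> hw [ic hc]; split; first exact: invariant_shift.
exact/gcobound_gcocycle/shift_gcobound.
Qed.

Lemma inv_cocycleD k c d :
  inv_cocycle k c -> inv_cocycle k d -> inv_cocycle k (c + d).
Proof.
by move=> [ic hc] [id hd]; split; [exact: invariantD|exact: gcocycleD].
Qed.

Lemma inv_cocycle_cup k l c d : inv_cocycle k c -> inv_cocycle l d ->
  inv_cocycle (k + l) (cup_at k c d).
Proof.
by move=> [ic hc] [id hd]; split; [exact: invariant_cup|exact: gcocycle_cup].
Qed.

Lemma inv_cobound_eq k c d : eqg k c d -> inv_cobound k c -> inv_cobound k d.
Proof. by move=> /eqg_sym h [b ib h']; exists b => //; exact: eqg_trans h'. Qed.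

Lemma invariant0 : invariant 0.
Proof. by split. Qed.

Lemma eqg_inv_cobound k c : eqg k c 0 -> inv_cobound k c.
Proof.
move=> h; exists 0; first exact: invariant0.
by apply: eqg_trans h _; apply: eqgW => s _; rewrite bd0.
Qed.

Lemma inv_cobound0 k : inv_cobound k 0.
Proof. exact/eqg_inv_cobound/eqg_refl. Qed.

Lemma inv_coboundD k c d :
  inv_cobound k c -> inv_cobound k d -> inv_cobound k (c + d).
Proof.
move=> [b ib h] [b' ib' h']; exists (b + b'); first exact: invariantD.
by apply: eqg_trans (eqgD h h') _; apply: eqgW => s _; rewrite bdD.
Qed.

Lemma inv_cobound_trans k d c e :
  inv_cobound k (c + d) -> inv_cobound k (d + e) -> inv_cobound k (c + e).
Proof.
move=> h1 h2; have := inv_coboundD h1 h2.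
by rewrite addrA -(addrA c) addcc addr0.
Qed.

Lemma inv_cobound_gcobound k c : inv_cobound k c -> gcobound k c.
Proof. by move=> [b [b0 _] h]; exists b. Qed.

Lemma inv_cobound_shift k w c : equivariant w -> inv_cobound k c ->
  inv_cobound k.+1 (shift w c).
Proof.
move=> hw [b ib h]; exists (shift w b); first exact: invariant_shift.
apply: eqg_trans (eqg_shift w h) _; apply: eqgW => s _.
rewrite /shift !fctE bdD bd_bd add0r.
have -> : scale w (bd (bd b)) s = 0 by rewrite /scale bd_bd mulr0.
by rewrite addr0.
Qed.

(** All the operators [shift w] induce the same map in equivariant cohomology,
    namely the product with the class of the double covering. *)
Lemma shift_indep k w w' c : equivariant w -> equivariant w' ->
  inv_cocycle k c -> inv_cobound k.+1 (shift w c + shift w' c).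
Proof.
move=> hw hw' [[c0 ci] hc]; exists (scale w c + scale w' c).
  split; first by rewrite !fctE /scale c0 !mulr0 addr0.
  have -> : pullg (scale w c + scale w' c) =
    pullg (scale w c) + pullg (scale w' c) by [].
  by rewrite !pullg_scale // ci addrACA addcc addr0.
apply: eqg_trans (eqgD (shift_cocycle w hc) (shift_cocycle w' hc)) _.
by apply: eqgW => s _; rewrite bdD.
Qed.

Lemma gcobound_pullg k c : gcobound k c -> gcobound k (pullg c).
Proof.
move=> [b b0 h]; exists (pullg b) => //.
by rewrite bd_pullg; exact: eqg_pullg.
Qed.

Lemma gcocycle_pullg k c : gcocycle k c -> gcocycle k (pullg c).
Proof. by move=> /eqg_pullg; rewrite -bd_pullg. Qed.

Lemma transfer_gcobound k c : gcobound k c -> inv_cobound k (transfer c).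
Proof.
move=> [b b0 h]; exists (transfer b); first exact: invariant_transfer.
by apply: eqg_trans (eqg_transfer h) _; rewrite transfer_bd; exact: eqg_refl.
Qed.

(** The involution acts trivially on a group with at most two elements. *)
Lemma transfer_spans k (x : seq X -> bool) c : spans k x -> gcocycle k c ->
  gcobound k (transfer c).
Proof.
move=> [_ sx] hc; have [c0|cx] := sx _ hc.
  exact/inv_cobound_gcobound/transfer_gcobound.
have [c0|cx'] := sx _ (gcocycle_pullg hc).
  apply/inv_cobound_gcobound/transfer_gcobound.
  apply: gcobound_eq (gcobound_pullg c0); apply: eqgW => s _.
  by rewrite /pullg map_gg.
by have := gcoboundD cx cx'; rewrite addrACA addcc addr0.
Qed.

Section Gysin.
Variable w : seq X -> bool.
Hypothesis hw : equivariant w.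

(** If [shift w c] is the coboundary of an invariant [b], then
    [scale w c + b] is a cocycle whose transfer is [c]. *)
Lemma gysin_shift k c : inv_cocycle k c -> inv_cobound k.+1 (shift w c) ->
  exists2 e, gcocycle k e & inv_cobound k (c + transfer e).
Proof.
move=> [ic hc] [b ib h]; exists (scale w c + b).
  have := eqgD (eqg_trans (eqg_sym (shift_cocycle w hc)) h)
    (eqg_refl k.+1 (bd b)).
  rewrite addcc; apply: eqg_trans; apply: eqgW => s _; exact: bdD.
rewrite transferD transfer_scale // (transfer_invariant ib) addr0 addcc.
exact: inv_cobound0.
Qed.

(** The invariant splitting of a primitive [b] of [c] exhibits [c] as the sum of
    an invariant coboundary and of [shift w (transfer b)]. *)
Lemma gysin_restriction k c : inv_cocycle k.+1 c -> gcobound k.+1 c ->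
  exists2 b, inv_cocycle k b & inv_cobound k.+1 (c + shift w b).
Proof.
move=> [ic hc] [b b0 h].
have Zb : gcocycle k (transfer b).
  rewrite /gcocycle -transfer_bd; apply: eqg_trans (eqg_transfer (eqg_sym h)) _.
  by rewrite (transfer_invariant ic); exact: eqg_refl.
exists (transfer b); first by split=> //; exact: invariant_transfer.
exists (b + scale w (transfer b)); first exact: invariant_split.
apply: eqg_trans (eqgD h (shift_cocycle w Zb)) _.
by apply: eqgW => s _; rewrite bdD.
Qed.

(** Subtracting the coboundary of [scale w b], where [b] is an invariant
    primitive of [transfer e], makes the transfer of [e] germwise zero, that is,
    [e] germwise invariant. *)
Lemma gysin_transfer k e : gcocycle k e -> inv_cobound k (transfer e) ->
  exists2 a, inv_cocycle k a & gcobound k (e + a).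
Proof.
(* The value at the empty sequence does not affect the class. *)
wlog e0 : e / e [::] = 0 => [hyp he ht|he [b [b0 bi] h]].
  pose e' : seq X -> bool := fun s => if s is [::] then 0 else e s.
  have ee' : eqg k e e' by apply: eqgW; case.
  have [a Za ha] := hyp e' erefl (gcocycle_eq ee' he)
    (inv_cobound_eq (eqg_transfer ee') ht).
  exists a => //; apply: gcobound_eq ha.
  by apply: eqgD (eqg_refl _ _); exact: eqg_sym.
pose e' := e + bd (scale w b).
have te' : eqg k (transfer e') 0.
  rewrite /e' transferD transfer_bd transfer_scale //.
  rewrite -[X in eqg _ _ X](addcc (bd b)).
  exact: eqgD h (eqg_refl _ _).
have ee' : eqg k e' (e' + scale w (transfer e')).
  rewrite -[X in eqg _ X _]addr0; apply: eqgD (eqg_refl _ _) _.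
  apply: eqg_sym; apply: eqg_trans (eqg_scale w te') _.
  by apply: eqgW => s _; rewrite /scale mulr0.
exists (e' + scale w (transfer e')).
  split; first by apply: invariant_split => //; rewrite /e' fctE e0 addr0.
  by apply: gcocycle_eq ee' _; apply: gcocycleD he (gcocycle_bd _ _).
apply: gcobound_eq (eqgD (eqg_refl k e) ee') _.
rewrite /e' addrA addcc add0r; exists (scale w b); last exact: eqg_refl.
by rewrite /scale b0 mulr0.
Qed.

End Gysin.

Lemma inv_cobound_cup k l c d : inv_cobound k c -> inv_cocycle l d ->
  inv_cobound (k + l) (cup_at k c d).
Proof.
case: k => [|k] hc [id hd].
  apply: eqg_inv_cobound; have /gcobound0P h := inv_cobound_gcobound hc.
  apply: eqg_trans (eqg_cup h (eqg_refl l d)) _.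
  by apply: eqgW => s _; rewrite /cup_at mul0r.
case: hc => b ib h; exists (cup_at k b d); first exact: invariant_cup.
apply: eqg_trans (eqg_cup h (eqg_refl l d)) _.
have h2 := eqg_cup (eqg_refl k b) hd; rewrite addnS in h2.
apply: germwise_mp h2 => s h2 e; rewrite (bd_cup _ _ e) h2 //.
by rewrite {3}/cup_at mulr0 mulr0 addr0.
Qed.

End Involution.

(** * Nilpotence of the characteristic class *)

Lemma size_undup_ltn (T : choiceType) (s t : seq T) : {subset t <= s} ->
  [set` t] <> [set` s] -> (size (undup t) < size (undup s))%N.
Proof.
move=> ts neq; have uts : {subset undup t <= undup s}.
  by move=> x; rewrite !mem_undup; exact: ts.
rewrite ltn_neqAle (uniq_leq_size (undup_uniq t) uts) andbT.
apply/eqP => e; apply: neq.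
have [_ h] := uniq_min_size (undup_uniq t) uts (eq_leq (esym e)).
by apply/seteqP; split=> x /=; [exact: ts|rewrite -mem_undup -h mem_undup].
Qed.

(** The value at [s] is the sum of [(w s + w t) * c t] over the faces [t] of
    [s]. *)
Lemma shift_eq0 (X : topologicalType) (w c : seq X -> bool) s :
  (forall t, size t = (size s).-1 -> {subset t <= s} ->
    w t = w s \/ c t = 0) -> shift w c s = 0.
Proof.
move=> h; have -> : shift w c s = bd (scale w c + (fun t => w s * c t)) s.
  by rewrite bdD bdZ.
rewrite -[RHS](bd0 bool s); apply: eq_bd => t st ts; rewrite !fctE /scale.
by case: (h t st ts) => ->; rewrite ?mulr0 ?addr0 //; exact: addbb.
Qed.

Section Nilpotence.
Variables (X : topologicalType) (g : X -> X).
Hypotheses (gcont : continuous g) (gg : involutive g).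
Implicit Types (s t : seq X).

Local Notation one := (@unit_cochain X).

Definition first_mark (phi : X -> bool) s :=
  if s is x :: _ then phi x else false.

Lemma equivariant_first_mark phi : (forall x, phi (g x) = ~~ phi x) ->
  equivariant g (first_mark phi).
Proof. by move=> h [|x s] //= _; rewrite h. Qed.

Lemma inv_cocycle_unit : inv_cocycle g 0 one.
Proof.
split; first by split=> //; apply/funext => -[].
by apply: eqgW => -[|? [|? []]].
Qed.

Lemma inv_cocycle_iter w j k c : equivariant g w -> inv_cocycle g k c ->
  inv_cocycle g (k + j) (iter j (shift w) c).
Proof.
move=> hw hc; elim: j => [|j IH]; rewrite ?addn0 //= addnS.
exact: inv_cocycle_shift.
Qed.

Lemma shift_iter_indep w w' j : equivariant g w -> equivariant g w' ->
  inv_cobound g j (iter j (shift w) one +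
                iter j (shift w') one).
Proof.
move=> hw hw'; elim: j => [|j IH] /=.
  by rewrite addcc; exact: inv_cobound0.
apply: (@inv_cobound_trans _ _ _ (shift w (iter j (shift w') one))).
  by rewrite -shiftD; exact: inv_cobound_shift.
apply: shift_indep => //.
exact: (inv_cocycle_iter (k := 0) j hw' inv_cocycle_unit).
Qed.

Variables (V : set (set X)) (d : nat).
Hypotheses (oV : open_cover V) (dV : cover_dim_le V d).
Hypothesis V_free : forall A x, V A -> A x -> ~ A (g x).

Section Labels.
Variables (al : X -> set X) (phi : X -> bool).
Hypotheses (hal : picks V al) (hphi : forall x, phi (g x) = ~~ phi x).

Let lab1 s := map al s.
Let lab2 s := map (fun x => al (g x)) s.
Let labels s : set (set X) * set (set X) := ([set` lab1 s], [set` lab2 s]).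
Let linked z s := {in s, forall x, al x z /\ al (g x) (g z)}.

(** The pair of label sets of a linked sequence is exchanged by [g] and its two
    members differ, because no member of [V] contains both [z] and [g z].  So a
    marking of such pairs gives an equivariant function that depends on the
    label sets only. *)
Lemma equivariant_labels : exists2 mu, equivariant g mu &
  forall z s t, s != [::] -> t != [::] -> linked z s -> linked z t ->
    labels s = labels t -> mu s = mu t.
Proof.
have [m hm] := @involution_marking _ (fun F => (F.2, F.1) :
  set (set X) * set (set X)) (fun F => let: (A, B) := F in erefl).
have labels_g s : labels (map g s) = ((labels s).2, (labels s).1).
  have E1 : lab1 (map g s) = lab2 s by rewrite /lab1 -map_comp.
  have E2 : lab2 (map g s) = lab1 s.
    by rewrite /lab2 -map_comp; apply: eq_map => x /=; rewrite gg.
  by rewrite /labels E1 E2.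
(* Off the linked sequences [first_mark] keeps the function equivariant. *)
exists (fun s => if `[< (labels s).1 = (labels s).2 >] then first_mark phi s
  else m (labels s)).
  move=> s s0; rewrite labels_g /=.
  case: asboolP => [e|ne]; case: asboolP => [e'|ne'].
  - exact: equivariant_first_mark.
  - by case: ne'.
  - by case: ne.
  - by apply: (hm (labels s)) => -[e _]; apply: ne; rewrite e.
have neq z s : s != [::] -> linked z s -> (labels s).1 <> (labels s).2.
  move=> s0 sz e; have [x xs] : exists x, x \in s.
    by case: s s0 {sz e} => // x s _; exists x; exact: mem_head.
  have : [set` lab2 s] (al (g x)) by apply: (map_f (fun x => al (g x))).
  rewrite -[[set` _]]e => /mapP[y ys ey].
  have [_ gz] := sz x xs; have [yz _] := sz y ys; have [VA _] := hal y.
  by apply: (V_free VA yz); rewrite -ey.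
move=> z s t s0 t0 sz tz e.
case: asboolP => [/(neq z _ s0 sz)//|_].
case: asboolP => [/(neq z _ t0 tz)//|_].
by rewrite e.
Qed.

(** Removing a vertex changes the value of [mu] only when it removes a label,
    so that each application of [shift mu] consumes one of the finitely many
    labels of a sequence. *)
Lemma iter_shift_eq0 mu :
  (forall z s t, s != [::] -> t != [::] -> linked z s -> linked z t ->
    labels s = labels t -> mu s = mu t) ->
  forall j s z, linked z s -> size s = j.+1 ->
    (size (undup (lab1 s)) + size (undup (lab2 s)) <= j)%N ->
    iter j (shift mu) one s = 0.
Proof.
move=> hmu; elim=> [|j IH] s z sz ss /=; first by case: s ss sz => [|x []].
move=> le_j; apply: shift_eq0 => t; rewrite ss /= => st ts.
have tz : linked z t by move=> x /ts; exact: sz.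
have sub1 : {subset lab1 t <= lab1 s}.
  by move=> _ /mapP[x xt ->]; apply: map_f; exact: ts.
have sub2 : {subset lab2 t <= lab2 s}.
  by move=> _ /mapP[x xt ->]; apply: (map_f (fun x => al (g x))); exact: ts.
have [e|ne] := pselect (labels t = labels s).
  left; apply: (hmu z) => //; first by rewrite -size_eq0 st.
  by rewrite -size_eq0 ss.
right; apply: (IH t z) => //; rewrite -ltnS; apply: leq_trans le_j.
have le12 (T : eqType) (p q : seq T) : {subset p <= q} ->
    (size (undup p) <= size (undup q))%N.
  move=> pq; apply: uniq_leq_size (undup_uniq _) _ => x.
  by rewrite !mem_undup; exact: pq.
have [e1|ne1] := pselect ([set` lab1 t] = [set` lab1 s]).
  rewrite -addnS; apply: leq_add (le12 _ _ _ sub1) _.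
  by apply: size_undup_ltn => // e2; apply: ne; rewrite /labels e1 e2.
by rewrite -addSn; apply: leq_add (le12 _ _ _ sub2); exact: size_undup_ltn.
Qed.

End Labels.

(** By [shift_indep] the iterates of the characteristic class may be computed
    with the function of the label sets; a linked sequence has at most [d + 1]
    labels of each of the two kinds. *)
Lemma characteristic_class_nilpotent phi : (forall x, phi (g x) = ~~ phi x) ->
  exists N, inv_cobound g N (iter N (shift (first_mark phi)) one).
Proof.
move=> hphi; have [al hal] := picks_ex oV.
have [mu hmu mu_labels] := equivariant_labels hal hphi.
pose N := (d.+1 + d.+1)%N; exists N.
rewrite -[X in inv_cobound _ _ X]addr0.
apply: inv_cobound_trans.
  exact: (shift_iter_indep N (equivariant_first_mark hphi) hmu).
rewrite addr0; apply: eqg_inv_cobound.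
exists (fun x => al x `&` g @^-1` al (g x)).
  apply: nbhd_choiceI; first exact: (picks_nbhd oV).
  move=> x; have [oA Ax] := picks_nbhd oV hal (g x); split=> //.
  by apply: open_comp oA => y _; exact: gcont.
move=> s z sz ss; have szl : {in s, forall x, al x z /\ al (g x) (g z)}.
  by move=> x /sz[].
apply: (iter_shift_eq0 mu_labels szl ss).
have bound (f : X -> set X) y : (forall x, V (f x)) ->
    {in s, forall x, f x y} -> (size (undup (map f s)) <= d.+1)%N.
  move=> Vf sy; case: {-1}(size _) (erefl (size (undup (map f s)))) => // k ek.
  rewrite ltnS; apply: (dV _ (undup_uniq (map f s))); split=> //.
    by move=> A; rewrite mem_undup => /mapP[x _ ->].
  by exists y => A /=; rewrite mem_undup => /mapP[x xs ->]; exact: sy.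
apply: leq_add.
  by apply: (bound al z) => [x|x /szl[]//]; have [] := hal x.
apply: (bound (fun x => al (g x)) (g z)) => [x|x /szl[]//].
by have [] := hal (g x).
Qed.

End Nilpotence.

(** * The ranks in the Gysin sequence *)

Section Chase.
Variables (X : topologicalType) (g : X -> X) (phi : X -> bool).
Hypotheses (gcont : continuous g) (gg : involutive g).
Hypothesis hphi : forall x, phi (g x) = ~~ phi x.
Implicit Types (b c d e : seq X -> bool).

Local Notation one := (@unit_cochain X).
Let w := first_mark phi.
Let tau := shift w.
Let hw : equivariant g w := equivariant_first_mark hphi.

Lemma iter_shiftD j c d :
  iter j tau (c + d) = iter j tau c + iter j tau d.
Proof. by elim: j => //= j ->; rewrite /tau shiftD. Qed.

(** The first mark of a sequence is that of its initial segment, so [tau] is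
    linear over the invariant cocycles. *)
Lemma shift_cup k l c d : gcocycle l d ->
  eqg (k + l).+1 (tau (cup_at k c d)) (cup_at k.+1 (tau c) d).
Proof.
move=> hd; have sc : scale w (cup_at k c d) = cup_at k (scale w c) d.
  by apply/funext => -[|x s]; rewrite /scale /cup_at /= mulrA.
have h1 := eqg_cup (eqg_refl k c) hd.
have h2 := eqg_cup (eqg_refl k (scale w c)) hd; rewrite !addnS in h1 h2.
apply: germwise_mp2 h1 h2 => s h1 h2 ss.
rewrite /tau /shift !fctE sc {2}/scale !(bd_cup _ _ ss) h1 // h2 //.
rewrite /cup_at /scale !mulr0 !addr0 mulrDl mulrA; congr (_ + _ * _ * _).
by case: (s).
Qed.

Lemma iter_shift_cup j l d : inv_cocycle g l d ->
  eqg (j + l) (iter j tau d) (cup_at j (iter j tau one) d).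
Proof.
move=> [[d0 _] hd]; elim: j => [|j IH] /=.
  by apply: eqgW => -[|x s] _; rewrite /cup_at /= ?d0 ?mulr0.
by rewrite addSn; apply: eqg_trans (eqg_shift w IH) (shift_cup _ _ hd).
Qed.

Lemma shift_transfer k e :
  gcocycle k e -> inv_cobound g k.+1 (tau (transfer g e)).
Proof.
move=> he; pose e' : seq X -> bool := fun s => if s is [::] then 0 else e s.
have ee' : eqg k e' e by apply: eqgW; case.
have he' := gcocycle_eq (eqg_sym ee') he.
apply: inv_cobound_eq (eqg_shift w (eqg_transfer gcont ee')) _.
have Zt : gcocycle k (transfer g e').
  by apply: gcocycleD => //; exact: gcocycle_pullg.
exists (e' + scale w (transfer g e')); first exact: invariant_split.
apply: eqg_trans (shift_cocycle w Zt) _.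
have := eqgD (eqg_sym he') (eqg_refl k.+1 (bd (scale w (transfer g e')))).
by rewrite add0r => h; apply: eqg_trans h _; apply: eqgW => s _; rewrite bdD.
Qed.

Lemma inv_cobound_cancel k c d :
  inv_cobound g k (c + d) -> inv_cobound g k d -> inv_cobound g k c.
Proof.
by move=> h1 h2; have := inv_coboundD h1 h2; rewrite -addrA addcc addr0.
Qed.

Lemma gcobound_cancel k c d :
  gcobound k (c + d) -> gcobound k d -> gcobound k c.
Proof.
by move=> h1 h2; have := gcoboundD h1 h2; rewrite -addrA addcc addr0.
Qed.

Definition transfer_trivial k :=
  forall e, gcocycle k e -> inv_cobound g k (transfer g e).

Lemma vanishing_transfer_trivial k :
  (forall e : seq X -> bool, gcocycle k e -> gcobound k e) ->
  transfer_trivial k.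
Proof. by move=> h e /h; exact: transfer_gcobound. Qed.

Lemma spans_transfer_trivial k (x : seq X -> bool) :
  spans k x -> inv_cobound g k (transfer g x) -> transfer_trivial k.
Proof.
move=> [_ sx] tx e /sx[h|h]; first exact: transfer_gcobound.
have := transfer_gcobound gcont gg h; rewrite transferD => h'.
exact: inv_cobound_cancel h' tx.
Qed.

(** Where the transfer vanishes, the multiplication by the characteristic class
    is injective. *)
Lemma shift_inj k c : transfer_trivial k -> inv_cocycle g k c ->
  inv_cobound g k.+1 (tau c) -> inv_cobound g k c.
Proof.
move=> tk Zc /(gysin_shift hw Zc)[e he h].
exact: inv_cobound_cancel h (tk e he).
Qed.

Lemma iter_shift_inj j k c :
  (forall i, (i < j)%N -> transfer_trivial (k + i)) -> inv_cocycle g k c ->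
  inv_cobound g (k + j) (iter j tau c) -> inv_cobound g k c.
Proof.
elim: j => [|j IH] tr Zc; rewrite ?addn0 // addnS /= => h.
apply: IH => //; first by move=> i ij; apply: tr; exact: ltnW.
by apply: shift_inj h; [exact: tr|exact: inv_cocycle_iter].
Qed.

Variables (n : nat) (x1 x2 x3 : seq X -> bool).
Hypothesis n_gt0 : (0 < n)%N.
Hypothesis vanish : forall k, k \notin [:: 0; n; n + n; n + (n + n)]%N ->
  forall e : seq X -> bool, gcocycle k e -> gcobound k e.
Hypotheses (s0 : spans 0 one) (nt0 : ~ gcobound 0 one).
Hypotheses (s1 : spans n x1) (nt1 : ~ gcobound n x1).
Hypotheses (s2 : spans (n + n) x2) (nt2 : ~ gcobound (n + n) x2).
Hypothesis s3 : spans (n + (n + n)) x3.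
Hypothesis x11 : gcobound (n + n) (cup_at n x1 x1 + x2).
Hypothesis x12 : gcobound (n + (n + n)) (cup_at n x1 x2).
Variable N : nat.
Hypothesis nilpotent : inv_cobound g N (iter N tau one).

Let out k : [|| (0 < k < n), (n < k < n + n), (n + n < k < n + (n + n)) |
  (n + (n + n) < k)]%N ->
  forall e : seq X -> bool, gcocycle k e -> gcobound k e.
Proof. by move=> h; apply: vanish; rewrite !inE; lia. Qed.

Let Zone : inv_cocycle g 0 one := inv_cocycle_unit g.

(** Below degree [n] the space looks like a point to the Gysin sequence: the
    only invariant classes are [0] and the power of the characteristic class. *)
Lemma low_degrees j c : (j < n)%N -> inv_cocycle g j c ->
  inv_cobound g j c \/ inv_cobound g j (c + iter j tau one).
Proof.
elim: j c => [|j IH] c jn [ic hc].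
  have [_ h0] := s0; have [/gcobound0P h|/gcobound0P h] := h0 _ hc.
    by left; exact: eqg_inv_cobound.
  by right; exact: eqg_inv_cobound.
have cB : gcobound j.+1 c by apply: out hc; rewrite jn.
have [b Zb hb] := gysin_restriction gcont gg hw (conj ic hc) cB.
have [h|h] := IH b (ltnW jn) Zb; [left|right].
  exact: inv_cobound_cancel hb (inv_cobound_shift hw h).
apply: inv_cobound_trans hb _; rewrite -shiftD; exact: inv_cobound_shift.
Qed.

(** Otherwise degree [3n] would carry the two classes [tau^(3n) 1] and
    [tau^(2n) y], while the transfer of [x3] is the only class that can be
    killed by [tau]. *)
Lemma transfer_generator_nonzero : ~ inv_cobound g n (transfer g x1).
Proof.
move=> t1; have [Z1 _] := s1; have [Z2 _] := s2.
have [y Zy x1y] := gysin_transfer gcont gg hw Z1 t1.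
have y_nz : ~ gcobound n y by move/(gcobound_cancel x1y).
have t2 : inv_cobound g (n + n) (transfer g x2).
  have h1 := gcobound_cupl x1y Z1; have h2 := gcobound_cupr Zy.2 x1y.
  have h : gcobound (n + n) (x2 + cup_at n y y).
    have := gcoboundD x11 (gcoboundD h1 h2); apply: gcobound_eq.
    apply: eqgW => s _; rewrite !fctE /cup_at.
    by case: (x1 _); case: (y _); case: (x1 _); case: (y _); case: (x2 _).
  have := transfer_gcobound gcont gg h.
  by rewrite transferD (transfer_invariant (inv_cocycle_cup Zy Zy).1) addr0.
have tr k : k != (n + (n + n))%N -> transfer_trivial k.
  move=> k3; have [k0|k0] := eqVneq k 0%N.
    rewrite k0; apply: spans_transfer_trivial s0 _.
    by rewrite (transfer_invariant Zone.1); exact: inv_cobound0.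
  have [->|k1] := eqVneq k n; first exact: spans_transfer_trivial s1 t1.
  have [->|k2] := eqVneq k (n + n)%N; first exact: spans_transfer_trivial s2 t2.
  apply: vanishing_transfer_trivial; apply: vanish.
  by rewrite !inE !negb_or k0 k1 k2 k3.
(* Beyond degree [3n] nothing is killed by [tau], so its nilpotence forces every
   class of degree [3n] into its kernel. *)
have top c : inv_cocycle g (n + (n + n)) c ->
    inv_cobound g (n + (n + n)) (c + transfer g x3) \/
    inv_cobound g (n + (n + n)) c.
  move=> Zc; have kill : inv_cobound g (n + (n + n)).+1 (tau c).
    have hN : inv_cobound g ((n + (n + n)).+1 + N) (iter N tau (tau c)).
      have Ztc := inv_cocycle_shift hw Zc; rewrite addnC.
      apply: inv_cobound_eq (eqg_sym (iter_shift_cup N Ztc)) _.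
      exact: inv_cobound_cup nilpotent Ztc.
    apply: iter_shift_inj hN; last exact: inv_cocycle_shift.
    by move=> i _; apply: tr; lia.
  have [e he h] := gysin_shift hw Zc kill.
  have [_ h3] := s3; have [e0|ex] := h3 _ he.
    by right; apply: inv_cobound_cancel h (transfer_gcobound gcont gg e0).
  left; apply: inv_cobound_trans h _; rewrite -transferD.
  exact: transfer_gcobound.
pose A := iter (n + n) tau (iter n tau one).
pose B := iter (n + n) tau y.
have ZA : inv_cocycle g (n + (n + n)) A.
  exact/(inv_cocycle_iter _ hw)/(inv_cocycle_iter (k := 0) _ hw Zone).
have ZB : inv_cocycle g (n + (n + n)) B by exact/(inv_cocycle_iter _ hw).
have A_nz : ~ inv_cobound g (n + (n + n)) A.
  rewrite /A -iterD (addnC (n + n)%N) => h; apply: nt0.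
  apply/inv_cobound_gcobound/(@iter_shift_inj (n + (n + n)) 0) => // i ij.
  by apply: tr; rewrite add0n ltn_eqF.
have inj c : inv_cocycle g n c ->
    inv_cobound g (n + (n + n)) (iter (n + n) tau c) -> inv_cobound g n c.
  by move=> Zc; apply: iter_shift_inj => // i ij; apply: tr; lia.
have B_nz : ~ inv_cobound g (n + (n + n)) B.
  by move=> /(inj _ Zy)/inv_cobound_gcobound.
have [hA|//] := top A ZA; have [hB|//] := top B ZB.
have hAB : inv_cobound g (n + (n + n)) (A + B).
  by apply: inv_cobound_trans hA _; rewrite addrC.
(* The difference of the two classes is the image of [tau^n 1 + y], so [y] would
   be a multiple of [tau] and restrict to zero. *)
apply: y_nz; have Zt := inv_cocycle_iter (k := 0) n hw Zone.
have : inv_cobound g n (y + iter n tau one).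
  by apply: inj; [exact: inv_cocycleD|rewrite iter_shiftD addrC].
move=> /inv_cobound_gcobound h; apply: gcobound_cancel h _.
case: (n) n_gt0 => // m _; rewrite iterS; apply: shift_gcobound.
by have [] := inv_cocycle_iter (k := 0) m hw Zone.
Qed.

(** Otherwise the transfer of [x1] would be [tau^n 1], and [x2] the restriction
    of some [y]; the transfer of [x1 x2 = 0] is then [tau^n y], yet [tau] is
    injective between the degrees [2n] and [3n]. *)
Lemma transfer_generator_zero : inv_cobound g n (transfer g x1).
Proof.
apply: contrapT => nt; have [Z1 h1] := s1; have [Z2 _] := s2.
case en: n n_gt0 => [//|m] _.
have low b : inv_cocycle g m b -> inv_cobound g n (tau b) \/
    inv_cobound g n (tau b + iter n tau one).
  move=> Zb; have [|h|h] := low_degrees (j := m) _ Zb; first by rewrite en.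
    by left; rewrite en; exact: inv_cobound_shift.
  by right; rewrite en /= -shiftD; exact: inv_cobound_shift.
have x1_top : inv_cobound g n (transfer g x1 + iter n tau one).
  have Zt : inv_cocycle g n (transfer g x1).
    split; first exact: invariant_transfer.
    by apply: gcocycleD => //; exact: gcocycle_pullg.
  have := transfer_spans gcont gg s1 Z1; rewrite en in Zt *.
  move=> /(gysin_restriction gcont gg hw Zt)[b Zb h].
  move: (low b Zb); rewrite en => -[h'|h'].
    by case: nt; rewrite en; exact: inv_cobound_cancel h h'.
  exact: inv_cobound_trans h h'.
(* In degree [n] only [0] and the transfer of [x1] are left, and [tau] kills
   transfers; every class of degree from [n + 1] to [2n - 1] is then zero. *)
have mid i c : (i < n)%N -> inv_cocycle g (n + i) c ->
    inv_cobound g (n + i).+1 (tau c).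
  elim: i c => [|i IH] c i_n.
    rewrite addn0 => -[ic hc]; have [cB|cx] := h1 c hc; last first.
      have := transfer_gcobound gcont gg cx; rewrite transferD.
      by rewrite (transfer_invariant ic) add0r => /nt.
    have Zc : inv_cocycle g n c by split.
    have : inv_cobound g n c \/ inv_cobound g n (c + transfer g x1).
      rewrite en in Zc cB.
      have [b Zb h] := gysin_restriction gcont gg hw Zc cB.
      rewrite -en in h; have [h'|h'] := low b Zb; [left|right].
        exact: inv_cobound_cancel h h'.
      apply: inv_cobound_trans h _; apply: inv_cobound_trans h' _.
      by rewrite addrC.
    case=> h; first exact: inv_cobound_shift.
    have := inv_cobound_shift hw h; rewrite shiftD => h'.
    exact: inv_cobound_cancel h' (shift_transfer Z1).
  rewrite addnS => Zc; apply: inv_cobound_shift => //.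
  have cB : gcobound (n + i).+1 c by apply: out Zc.2; lia.
  have [b Zb h] := gysin_restriction gcont gg hw Zc cB.
  exact: inv_cobound_cancel h (IH b (ltnW i_n) Zb).
have t2 : inv_cobound g (n + n) (transfer g x2).
  have Zt : inv_cocycle g (n + n) (transfer g x2).
    split; first exact: invariant_transfer.
    by apply: gcocycleD => //; exact: gcocycle_pullg.
  have tB := transfer_spans gcont gg s2 Z2.
  have e2 : (n + n)%N = (n + m).+1 by rewrite {2}en addnS.
  rewrite e2 in Zt tB *; have [b Zb h] := gysin_restriction gcont gg hw Zt tB.
  by apply: inv_cobound_cancel h (mid _ _ _ Zb); rewrite en.
have [y Zy x2y] := gysin_transfer gcont gg hw Z2 t2.
apply: nt2; apply: (gcobound_cancel x2y); apply: inv_cobound_gcobound.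
have hy : inv_cobound g (n + (n + n)) (cup_at n (transfer g x1) y).
  have xyB : gcobound (n + (n + n)) (cup_at n x1 y).
    apply: gcobound_eq (gcoboundD x12 (gcobound_cupr Z1 x2y)).
    apply: eqgW => s _; rewrite !fctE /cup_at.
    by case: (x1 _); case: (x2 _); case: (y _).
  have := transfer_gcobound gcont gg xyB; apply: inv_cobound_eq.
  apply: eqgW => s _; rewrite /transfer /pullg !fctE /cup_at mulrDl.
  have yg t : y (map g t) = y t by rewrite -{2}Zy.1.2.
  by rewrite -map_take -map_drop yg.
have : inv_cobound g (n + n + n) (iter n tau y).
  rewrite addnC; apply: inv_cobound_eq (eqg_sym (iter_shift_cup n Zy)) _.
  apply: inv_cobound_cancel hy.
  have := inv_cobound_cup x1_top Zy; apply: inv_cobound_eq; apply: eqgW => s _.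
  by rewrite !fctE /cup_at -mulrDl addrC.
apply: iter_shift_inj Zy => -[|i] i_n.
  by rewrite addn0; exact: spans_transfer_trivial s2 t2.
by apply: vanishing_transfer_trivial; apply: out; lia.
Qed.

Lemma no_free_involution : False.
Proof. exact: transfer_generator_nonzero transfer_generator_zero. Qed.

End Chase.

(** * Free actions of the group of order 2 *)

Lemma cohomology_type_inhabited (X : topologicalType) (a b : int) :
  cohomology_type X a b -> exists x : X, True.
Proof.
move=> [n [_ _ [v0 [_ [_ [_ [[[deg vK _] _ _ _] _]]]]]]].
have [//|noX] := pselect (exists x : X, True).
suff v00 : v0 = 0 by have := vK 1; have := vK 0; rewrite v00 !mul0rz => ->.
elim/cech_ind: v0 {vK} => x.
have oW : open_cover (set0 : set (set X)).
  by split=> //; apply/seteqP; split=> // y; case: noX; exists y.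
apply/cech_classP; exists set0, id, (fun=> setT); split=> //.
  by move=> s [_ + [y _]]; case: noX; exists y.
Qed.

(** In a Hausdorff space every point has a neighbourhood disjoint from its
    translate by a fixed-point-free continuous map; a finite-dimensional
    refinement of these neighbourhoods inherits the property. *)
Lemma free_finite_dim_cover (X : topologicalType) (g : X -> X) :
  finitistic X -> continuous g -> (forall x, g x <> x) ->
  exists V d, [/\ open_cover V, cover_dim_le V d
    & forall A x, V A -> A x -> ~ A (g x)].
Proof.
move=> [hX _ fX] gcont gfree.
pose U := [set A : set X | open A /\ forall x, A x -> ~ A (g x)].
have oU : open_cover U.
  split=> [A []//|]; apply/seteqP; split=> // x _.
  have xg : x != g x by apply/eqP => /esym; exact: gfree.
  move: hX; rewrite open_hausdorff => /(_ _ _ xg)[[P Q]] /= [Px Qx] [oP oQ PQ].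
  exists (P `&` g @^-1` Q); last by split; exact/set_mem.
  split; first by apply: openI => //; apply: open_comp oQ => y _; exact: gcont.
  move=> y [_ Qy] [Py _]; have : (P `&` Q) (g y) by split.
  by move/eqP: PQ => ->.
have [V [oV VU [d dV]]] := fX U oU; exists V, d; split=> // A x VA Ax Agx.
have [B [_ hB] AB] := VU A VA; exact: (hB x (AB _ Ax) (AB _ Agx)).
Qed.

Lemma Z2_free_action_involution (X : topologicalType)
    (to : {action 'Z_2 &-> X}) (g := fun x => to x (1%R : 'Z_2)) :
  free_action to -> involutive g /\ forall x, g x <> x.
Proof.
move=> free; split=> x.
  have [inj mul] : is_action [set: 'Z_2]%SET to by case: (to).
  have to_mul y h k : to y (h * k)%g = to (to y h) k by rewrite mul ?inE.
  rewrite /g -to_mul (_ : (_ * _)%g = 1%g); last exact: val_inj.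
  by apply: (inj 1%g); rewrite -to_mul mulg1.
move=> gx; have : (1%R : 'Z_2) \in isotropy to x by rewrite inE; apply/eqP.
by rewrite free inE.
Qed.

Theorem theorem3p1 (X : topologicalType) (a b : int)
    (Xfin : finitistic X) (Xab : cohomology_type X a b)
    (a_odd : ~~ (2 %| a)%Z) (b_even : (2 %| b)%Z) :
  ~ exists to : {action 'Z_2 &-> X}, continuous_action to /\ free_action to.
Proof.
move=> [to [cont /Z2_free_action_involution[gg gfree]]].
set g := (fun x => _) in gg gfree; have gcont : continuous g := cont 1%R.
have [x0 _] := cohomology_type_inhabited Xab.
have [V [d [oV dV Vfree]]] := free_finite_dim_cover Xfin gcont gfree.
have [phi phi_g] := involution_marking gg.
have hphi x : phi (g x) = ~~ phi x := phi_g x (@gfree x).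
have [N nilpotent] := characteristic_class_nilpotent gcont gg oV dV Vfree hphi.
have [n [x1 [x2 [x3 [n0 [vanish [s0 t0] [s1 t1] [s2 t2] [s3 x11 x12]]]]]]] :=
  mod2_cohomology x0 Xab a_odd b_even.
exact: (no_free_involution gcont gg hphi n0 vanish s0 t0 s1 t1 s2 t2 s3
  x11 x12 nilpotent).
Qed.
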